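(* Let $m\ge 2$ be a fixed natural number, let $T\in(0,m-1]$, and let $g:[0,T]\to\mathbb{R}$ be given by $g(t)=t^m$. Then $$\lim_{\beta\to0^+}\frac{\left\|{}^{CF}D^{1-\beta}g-g'\right\|_{L^1(0,T)}}{\left\|{}^{C}D^{1-\beta}g-g'\right\|_{L^1(0,T)}}=\frac{m-T}{T}\,\frac{1}{\Psi(m+1)-\ln T},$$ where ${}^{CF}D^{1-\beta}$ and ${}^{C}D^{1-\beta}$ are the fractional Caputo--Fabrizio and Caputo derivatives of order $1-\beta$ with base point $0$, and $\Psi(x)=\frac{\Gamma'(x)}{\Gamma(x)}$, $x\in\mathbb{R}\setminus\{0,-1,-2,\dots\}$, is the Digamma function.
   Context: For $\beta\in(0,1)$ and $g\in W^{1,1}(0,T)$ (the Sobolev space of $L^1$ functions with weak derivative in $L^1$), the fractional Caputo--Fabrizio and Caputo derivatives of order $1-\beta$ with base point $0$ are $${}^{CF}D^{1-\beta}g(t)=\frac{1}{\beta}\int_0^t g'(\tau)\,e^{-\frac{1-\beta}{\beta}(t-\tau)}\,\mathrm{d}\tau,\qquad {}^{C}D^{1-\beta}g(t)=\frac{1}{\Gamma(\beta)}\int_0^t g'(\tau)\,(t-\tau)^{\beta-1}\,\mathrm{d}\tau .$$ *)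

(* Defs.v *)
From mathcomp Require Import all_boot all_order all_algebra.
From mathcomp Require Import all_classical all_reals all_analysis.
Import Order.TTheory GRing.Theory Num.Theory.
Import numFieldNormedType.Exports.

Set Implicit Arguments.
Unset Strict Implicit.
Unset Printing Implicit Defensive.

Local Open Scope classical_set_scope.
Local Open Scope ring_scope.

Definition Euler_integral (R : realType) (x : R) : R :=
  \int[lebesgue_measure]_(t in `]0, +oo[) (t `^ (x - 1) * expR (- t)).

(* The Gamma function off the poles 0, -1, -2, ...: with n the least natural
   number such that 0 < x + n, Gamma(x) = Gamma(x + n) / (x (x+1) ... (x+n-1)).
   As truncn vanishes below 1, n = 0 for 0 < x, where Gamma is Euler's
   integral. At the poles the value is 0. *)
Definition Gamma (R : realType) (x : R) : R :=
  let n := Num.truncn (1 - x) in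
  Euler_integral (x + n%:R) / \prod_(i < n) (x + i%:R).

Definition digamma (R : realType) (x : R) : R := (@Gamma R)^`()%classic x / Gamma x.

(* C_c^oo(0, T), its elements being extended by 0 to the whole line. *)
Definition test_function (R : realType) (T : R) (phi : R -> R) : Prop :=
  (forall (n : nat) (x : R), derivable phi^`(n)%classic x 1) /\
  exists K : set R, [/\ compact K, K `<=` `]0, T[ &
    forall x : R, ~ K x -> phi x = 0].

(* g is in W^{1,1}(0, T), and h represents its weak derivative. *)
Definition is_W11_derivative (R : realType) (T : R) (g h : R -> R) : Prop :=
  [/\ lebesgue_measure.-integrable `]0, T[ (EFin \o g),
      lebesgue_measure.-integrable `]0, T[ (EFin \o h) &
      forall phi : R -> R, test_function T phi ->
        \int[lebesgue_measure]_(x in `]0, T[) (g x * phi^`()%classic x) =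
        - \int[lebesgue_measure]_(x in `]0, T[) (h x * phi x)].

(* A representative of the weak derivative of g on (0, T), unique up to a null
   set; it is 0 by convention if g is not in W^{1,1}(0, T). *)
Definition weak_derivative (R : realType) (T : R) (g : R -> R) : R -> R :=
  xget (cst 0) [set h | is_W11_derivative T g h].

(* The two fractional derivatives are those of order 1 - b and base point 0,
   for g in W^{1,1}(0, T) and 0 < t < T. *)
Definition Caputo_Fabrizio (R : realType) (T b : R) (g : R -> R) (t : R) : R :=
  b^-1 * \int[lebesgue_measure]_(s in `[0, t])
           (weak_derivative T g s * expR (- ((1 - b) / b) * (t - s))).

Definition Caputo (R : realType) (T b : R) (g : R -> R) (t : R) : R :=
  (Gamma b)^-1 * \int[lebesgue_measure]_(s in `[0, t])
                   (weak_derivative T g s * (t - s) `^ (b - 1)).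

(* fine sends an infinite norm to 0; the value is meaningful for f in L^1(0, T). *)
Definition L1norm (R : realType) (T : R) (f : R -> R) : R :=
  fine 'N[lebesgue_measure]_1[EFin \o (f \_ `]0, T[)].

(* Main.v *)
Require Import Defs.
From mathcomp Require Import all_boot all_order all_algebra.
From mathcomp Require Import all_classical all_reals all_analysis.
From mathcomp Require Import measurable_realfun.
From mathcomp Require Import ring lra.
Import Order.TTheory GRing.Theory Num.Theory.
Import numFieldNormedType.Exports.

Local Open Scope classical_set_scope.
Local Open Scope ring_scope.

Set Implicit Arguments.
Unset Strict Implicit.
Unset Printing Implicit Defensive.

(** For g(t) = t^m both fractional derivatives are explicit, and both differ from
    g' by a quantity of order b, so the limit is the quotient of the two first
    order coefficients.

    The sign is what makes the norms computable. On ]0, T[, as T <= m - 1, both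
    fractional derivatives stay below g' for every b in ]0, 1[, so that each
    norm is the integral of g' minus an explicit function.

    Caputo-Fabrizio. With c = (1 - b)/b, the derivative is (m/b) y, where y solves
    y' + c y = t^(m-1), y(0) = 0 ([exp_conv], [Rintegral_exp_conv]). Comparing with
    the supersolution b t^(m-1) gives the sign ([exp_conv_le]), and integrating
    the equation itself gives the integral of y. The norm divided by b tends to
    m T^(m-1) - T^m ([cvg_L1norm_Caputo_Fabrizio]).

    Caputo. A beta integral ([Rintegral_beta]) and the functional equation of Gamma
    ([GammaD1]) give the derivative Gamma(m+1)/Gamma(m+b) t^(m+b-1). The norm of
    its error is T^m (1 - 1/r(b)) with r(b) = Gamma(m+1+b) T^(-b) / Gamma(m+1), and
    r(0) = 1, r'(0) = Psi(m+1) - ln T since Gamma is differentiable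
    ([derivable_Gamma]). The sign, and the fact that Psi(m+1) - ln T > 0, come
    from one inequality between values of Gamma, [Gamma_tangent], obtained by
    integrating s^b >= t^b (1 + b - b t/s).

    The weak derivative of g is an arbitrary representative; it agrees almost
    everywhere with m t^(m-1) ([weak_derivative_ae]). This is the fundamental lemma
    of the calculus of variations ([test0_ae0]), and it needs enough test
    functions: the bumps exp (- c / ((x-a) (b-x))), proved smooth by means of a
    family closed under differentiation ([bump_span]). *)

(** * The fundamental theorem of calculus and its improper forms *)

#[global] Instance is_derive_exprn (R : realType) n (x : R) :
  is_derive x 1 (fun y : R => y ^+ n) (n%:R * x ^+ n.-1).
Proof.
have -> : (fun y : R => y ^+ n) = (id : R -> R) ^+ n by rewrite exprfctE.
by apply: is_derive_eq; rewrite /GRing.scale/= mulr1.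
Qed.

Lemma continuous_is_derive (R : realType) (f : R -> R) (x d : R) :
  is_derive x 1 f d -> {for x, continuous f}.
Proof.
by move=> [df _]; apply: differentiable_continuous; exact/derivable1_diffP.
Qed.

Section primitives.
Variable R : realType.
Notation mu := (@lebesgue_measure R).
Implicit Types (f F : R -> R) (a b l : R).

Lemma FTC_within F f a b : a <= b ->
  (forall x, a <= x <= b -> is_derive x 1 F (f x)) ->
  (forall x, a <= x <= b -> {for x, continuous f}) ->
  (\int[mu]_(x in `[a, b]) (f x)%:E = (F b - F a)%:E)%E.
Proof.
rewrite le_eqVlt => /predU1P[<- _ _|ab dF cf].
  by rewrite set_itv1 integral_set1 subrr.
rewrite EFinB; apply: continuous_FTC2 => //.
- by apply: continuous_in_subspaceT => x; rewrite inE/= in_itv/= => /cf.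
- have cF x : a <= x <= b -> {for x, continuous F}.
    move=> /dF[dFx _]; apply: differentiable_continuous.
    exact/derivable1_diffP.
  split.
  + by move=> x; rewrite in_itv/= => /andP[/ltW ax /ltW xb]; case: (dF x);
      rewrite ?ax.
  + by apply: cvg_at_right_filter; apply: cF; rewrite lexx ltW.
  + by apply: cvg_at_left_filter; apply: cF; rewrite lexx ltW.
- move=> x; rewrite in_itv/= => /andP[/ltW ax /ltW xb].
  by rewrite derive1E; case: (dF x) => //; rewrite ax.
Qed.

Lemma Rintegral_FTC_within F f a b : a <= b ->
  (forall x, a <= x <= b -> is_derive x 1 F (f x)) ->
  (forall x, a <= x <= b -> {for x, continuous f}) ->
  \int[mu]_(x in `[a, b]) f x = F b - F a.
Proof. by move=> ab dF cf; rewrite /Rintegral (FTC_within ab dF cf). Qed.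

Lemma integrable_within f a b :
  (forall x, a <= x <= b -> {for x, continuous f}) ->
  mu.-integrable `[a, b] (EFin \o f).
Proof.
move=> cf; apply: continuous_compact_integrable; first exact: segment_compact.
by apply: continuous_in_subspaceT => x; rewrite inE/= in_itv/= => /cf.
Qed.

(** The integrands below are singular at an endpoint or live on a half-line, so
    the fundamental theorem is applied on the segments [u n, v n] exhausting
    the domain D; monotone convergence (for f >= 0) or dominated convergence
    (for f integrable) then passes to the limit. *)
Section exhaustion.
Variables (D : set R) (u v : nat -> R) (F f : R -> R) (l : R).
Hypothesis uN : {homo u : m n / (m <= n)%N >-> n <= m}.
Hypothesis vN : {homo v : m n / (m <= n)%N >-> m <= n}.
Hypothesis uv : forall n, u n <= v n.
Hypothesis DE : D = \bigcup_n `[u n, v n]%classic.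
Hypothesis dF : forall x, D x -> is_derive x 1 F (f x).
Hypothesis cf : forall x, D x -> {for x, continuous f}.
Hypothesis Fl : F (v n) - F (u n) @[n --> \oo] --> l.

Let E n : set R := `[u n, v n]%classic.

Let ED n : E n `<=` D.
Proof. by rewrite DE => x Ex; exists n. Qed.

Let mE n : measurable (E n). Proof. exact: measurable_itv. Qed.

Let ndE : nondecreasing_seq E.
Proof.
move=> m n mn; rewrite subsetEset => x; rewrite /E /= !in_itv/= => /andP[ux xv].
by rewrite (le_trans (uN mn))//= (le_trans xv)// vN.
Qed.

Let intE n : mu.-integrable (E n) (EFin \o f).
Proof.
by apply: integrable_within => x xuv; apply: cf; apply: (@ED n); rewrite /E/= in_itv.
Qed.

Let mf n : measurable_fun (E n) f.
Proof. by apply/measurable_EFinP; exact: (measurable_int mu (intE n)). Qed.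

Let FTCE n : (\int[mu]_(x in E n) (f x)%:E = (F (v n) - F (u n))%:E)%E.
Proof.
apply: FTC_within => // x xuv; [apply: dF|apply: cf]; apply: (@ED n);
  by rewrite /E/= in_itv.
Qed.

Lemma ge0_FTC_exhaustion : (forall x, D x -> 0 <= f x) ->
  (\int[mu]_(x in D) (f x)%:E = l%:E)%E.
Proof.
move=> f0.
have /cvg_lim <- // : ((F (v n) - F (u n))%:E @[n --> \oo] --> l%:E).
  exact: cvg_EFin (nearW _ _) Fl.
rewrite DE; apply/esym/cvg_lim => //.
under eq_fun do rewrite -FTCE.
apply: ge0_nondecreasing_set_cvg_integral => //.
  by move=> n; apply/measurable_EFinP; exact: mf.
by move=> n x /ED Dx; rewrite lee_fin f0.
Qed.

(** A sign is enough for integrability: the limit l of the increments of F is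
    finite. *)
Lemma ge0_FTC_exhaustion_integrable : (forall x, D x -> 0 <= f x) ->
  mu.-integrable D (EFin \o f).
Proof.
move=> f0; apply/integrableP; split.
  by apply/measurable_EFinP; rewrite DE; apply/measurable_fun_bigcup.
under eq_integral => x xD.
  rewrite /= ger0_norm; last by apply: f0; rewrite inE in xD.
  over.
by rewrite ge0_FTC_exhaustion// ltry.
Qed.

Lemma FTC_exhaustion : mu.-integrable D (EFin \o f) ->
  \int[mu]_(x in D) f x = l.
Proof.
move=> intf.
have mD : measurable D by rewrite DE; apply: bigcup_measurable => n _; exact: mE.
have mfD : measurable_fun D f by apply/measurable_EFinP; exact: (measurable_int mu intf).
suff : (\int[mu]_(x in E n) (f x)%:E @[n --> \oo] --> \int[mu]_(x in D) (f x)%:E)%E.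
  under eq_fun do rewrite FTCE.
  move=> /(cvg_lim (@ereal_hausdorff R)) fE.
  rewrite /Rintegral -fE.
  have /cvg_lim -> // : ((F (v n) - F (u n))%:E @[n --> \oo] --> l%:E).
  exact: cvg_EFin (nearW _ _) Fl.
have -> : (fun n => \int[mu]_(x in E n) (f x)%:E)%E =
    (fun n => \int[mu]_(x in D) ((EFin \o f) \_ (E n)) x)%E.
  apply/funext => n; rewrite -integral_mkcondr; congr (integral _ _ _).
  by apply/esym/setIidPr; exact: ED.
have := @dominated_convergence _ _ _ mu D mD
  (fun n => (EFin \o f) \_ (E n)) (EFin \o f) (fun x => `|f x|%:E).
case=> //.
- move=> n; apply/(measurable_restrict _ (mE n) mD).
  by apply/measurable_EFinP; apply: measurable_funS mfD => // x [].
- exact/measurable_EFinP.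
- apply: aeW => x Dx; apply: cvg_near_cst.
  move: (Dx); rewrite {1}DE => -[N _ ENx].
  near=> n; rewrite patchE mem_set//.
  have : E N `<=` E n.
    by rewrite -subsetEset; apply: ndE; near: n; exact: nbhs_infty_ge.
  exact.
- exact: integrable_norm.
- apply: aeW => x n Dx; rewrite patchE; case: ifPn => _ //=.
  by rewrite normr0 lee_fin normr_ge0.
Unshelve. all: by end_near. Qed.

End exhaustion.
End primitives.

(** The exhaustion of the open half-line by the segments [1/(n+1), n+1]; the
    increments of F are then controlled by its limits at 0 and at infinity. *)
Section half_line.
Variable R : realType.
Notation mu := (@lebesgue_measure R).
Variables (F f : R -> R) (l0 l1 : R).
Hypothesis dF : forall x : R, 0 < x -> is_derive x 1 F (f x).
Hypothesis cf : forall x : R, 0 < x -> {for x, continuous f}.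
Hypothesis F0 : F x @[x --> 0^'+] --> l0.
Hypothesis Fy : F x @[x --> +oo%R] --> l1.

Let u (n : nat) : R := n.+1%:R^-1.
Let v (n : nat) : R := n.+1%:R.

Let uN : {homo u : m n / (m <= n)%N >-> n <= m}.
Proof. by move=> m n mn; rewrite lef_pV2 ?posrE ?ltr0n// ler_nat. Qed.

Let vN : {homo v : m n / (m <= n)%N >-> m <= n}.
Proof. by move=> m n mn; rewrite ler_nat. Qed.

Let uv n : u n <= v n.
Proof. by rewrite (@le_trans _ _ 1) ?invf_le1 ?ltr0n ?ler1n. Qed.

Let DE : `]0, +oo[%classic = \bigcup_n `[u n, v n]%classic.
Proof.
apply/seteqP; split => x /=; last first.
  case=> n _ /=; rewrite !in_itv/= => /andP[ux _]; rewrite andbT.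
  by rewrite (lt_le_trans _ ux)// invr_gt0 ltr0n.
rewrite in_itv/= andbT => x0.
exists (Num.truncn (x + x^-1)) => //=; rewrite in_itv/=.
have xV0 : 0 < x^-1 by rewrite invr_gt0.
have /ltW h : x + x^-1 < (Num.truncn (x + x^-1)).+1%:R by exact: truncnS_gt.
apply/andP; split; last by apply: le_trans h; rewrite lerDl ltW.
rewrite /u -[leRHS]invrK lef_pV2 ?posrE ?ltr0n//.
by apply: le_trans h; rewrite lerDr ltW.
Qed.

Let D0 (x : R) : `]0, +oo[%classic x -> 0 < x :> R.
Proof. by rewrite /= in_itv/= andbT. Qed.

Let dF' (x : R) : `]0, +oo[%classic x -> is_derive x 1 F (f x).
Proof. by move=> /D0; exact: dF. Qed.

Let cf' (x : R) : `]0, +oo[%classic x -> {for x, continuous f}.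
Proof. by move=> /D0; exact: cf. Qed.

Let Fl : F (v n) - F (u n) @[n --> \oo] --> l1 - l0.
Proof.
apply: cvgB.
- apply: ((cvg_pinftyP F l1).1 Fy).
  apply/cvgryPge => A; near=> n; apply: (@le_trans _ _ n%:R); last by rewrite ler_nat.
  by near: n; exact: nbhs_infty_ger.
- apply: ((cvg_at_rightP F 0 l0).1 F0); split.
  + by move=> n; rewrite /u invr_gt0 ltr0n.
  + exact: cvg_harmonic.
Unshelve. all: by end_near. Qed.

Lemma ge0_FTC_half_line_integrable : (forall x : R, 0 < x -> 0 <= f x) ->
  mu.-integrable `]0, +oo[ (EFin \o f).
Proof.
move=> f0; apply: (ge0_FTC_exhaustion_integrable uN vN uv DE dF' cf' Fl).
by move=> x /D0; exact: f0.
Qed.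

Lemma FTC_half_line : mu.-integrable `]0, +oo[ (EFin \o f) ->
  \int[mu]_(x in `]0, +oo[) f x = l1 - l0.
Proof. exact: (FTC_exhaustion uN vN uv DE dF' cf' Fl). Qed.

End half_line.

(** * The Gamma function *)

Section gamma_kernel.
Variable R : realType.
Notation mu := (@lebesgue_measure R).
Implicit Types (x t k : R).

Definition gamma_kernel x t : R := t `^ (x - 1) * expR (- t).

Lemma gamma_kernel_ge0 x t : 0 <= gamma_kernel x t.
Proof. by rewrite mulr_ge0 ?powR_ge0 ?expR_ge0. Qed.

Lemma continuous_powR x t : 0 < t -> {for t, continuous (fun t => t `^ x)}.
Proof.
move=> t0; apply: differentiable_continuous; apply/derivable1_diffP.
by case: (is_derive1_powR x t0).
Qed.

Lemma continuous_expRN t : {for t, continuous (fun t => expR (- t))}.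
Proof.
by apply: continuous_comp; [exact: opp_continuous|exact: continuous_expR].
Qed.

Lemma continuous_gamma_kernel x t : 0 < t -> {for t, continuous (gamma_kernel x)}.
Proof.
by move=> t0; apply: continuousM; [exact: continuous_powR|exact: continuous_expRN].
Qed.

(** Write t = k (t/k) and use y <= exp y at y = t/k, raised to the power k: this
    way real exponents need no expansion of the exponential. *)
Lemma powR_le_expR k t : 0 < k -> 0 <= t -> t `^ k <= k `^ k * expR t.
Proof.
move=> k0 t0; have kn := ltW k0.
have tk : 0 <= t / k by rewrite divr_ge0.
rewrite -[t](divfK (lt0r_neq0 k0)) expRM mulrC powRM//.
apply: ler_wpM2l; first exact: powR_ge0.
apply: ge0_ler_powR; rewrite ?nnegrE ?expR_ge0//.
by apply: le_trans (expR_ge1Dx _); rewrite lerDr.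
Qed.

(** The right-hand side is a constant times the derivative of (t/(1+t))^x, a
    function that increases from 0 to 1. One bounded primitive thus controls
    the kernel near 0 and at infinity at once. *)
Lemma gamma_kernel_le x t : 0 < x -> 0 < t ->
  gamma_kernel x t <=
  ((x + 1) `^ (x + 1) * expR 1 / x) *
  (x * (t / (1 + t)) `^ (x - 1) * ((1 + t) ^- 2)).
Proof.
move=> x0 t0; have t1 : 0 < 1 + t by rewrite addr_gt0.
have x1 : 0 < x + 1 by rewrite addr_gt0.
set K := (x + 1) `^ (x + 1) * expR 1.
have -> : K / x * (x * (t / (1 + t)) `^ (x - 1) * (1 + t) ^- 2) =
    t `^ (x - 1) * (K / (1 + t) `^ (x + 1)).
  rewrite powRM ?invr_ge0; [|exact: ltW..].
  have -> : (1 + t)^-1 `^ (x - 1) = ((1 + t) `^ (x - 1))^-1.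
    by rewrite -(powR_inv1 (ltW t1)) powRAC powR_inv1// powR_ge0.
  rewrite (_ : x + 1 = (x - 1) + 2%:R); last by ring.
  rewrite (@powRD _ (1 + t) (x - 1) 2%:R); last by rewrite (gt_eqF t1) implybT.
  rewrite powR_mulrn; last exact: ltW.
  have := powR_gt0 (x - 1) t1; move: (t `^ _) ((1 + t) `^ _) => a b b0.
  by field; rewrite !gt_eqF.
rewrite ler_wpM2l ?powR_ge0// ler_pdivlMr ?powR_gt0//.
rewrite expRN mulrC ler_pdivrMr ?expR_gt0//.
by rewrite /K -mulrA -expRD; exact: powR_le_expR (ltW t1).
Qed.

Lemma cvgy_ratio : (t / (1 + t)) @[t --> +oo%R] --> (1 : R).
Proof.
have : (1 - (1 + t)^-1) @[t --> +oo%R] --> (1 - 0 : R).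
  apply: cvgB; first exact: cvg_cst.
  apply/gtr0_cvgV0.
    by near=> t; rewrite addr_gt0//; near: t; exact: nbhs_pinfty_gt.
  apply/cvgryPge => A; near=> t.
  have : A <= t by near: t; exact: nbhs_pinfty_ge (num_real _).
  by move=> At; rewrite (le_trans At)// lerDr.
rewrite subr0; apply: cvg_trans; apply: near_eq_cvg; near=> t.
have t1 : 0 < 1 + t by rewrite addr_gt0//; near: t; exact: nbhs_pinfty_gt.
by field; rewrite gt_eqF.
Unshelve. all: by end_near. Qed.

Lemma integrable_gamma_kernel x : 0 < x ->
  mu.-integrable `]0, +oo[ (EFin \o gamma_kernel x).
Proof.
move=> x0.
pose f t := x * (t / (1 + t)) `^ (x - 1) * ((1 + t) ^- 2).
pose F t : R := (t / (1 + t)) `^ x.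
have dratio t : 0 < t -> is_derive t 1 (fun t => t / (1 + t)) ((1 + t) ^- 2).
  move=> t0; have t1 : 0 < 1 + t by rewrite addr_gt0.
  have ? : is_derive t 1 (fun t : R => (1 + t)^-1) (- (1 + t) ^- 2 *: 1).
    apply: is_deriveV; first by rewrite gt_eqF.
    by apply: is_derive_eq; rewrite add0r.
  apply: is_derive_eq; rewrite /GRing.scale/=.
  by field; rewrite gt_eqF.
have ratio0 t : 0 < t -> 0 < t / (1 + t) by move=> t0; rewrite divr_gt0// addr_gt0.
have f0 t : 0 < t -> 0 <= f t.
  by move=> t0; rewrite !mulr_ge0 ?powR_ge0 ?(ltW x0)// invr_ge0 exprn_ge0// addr_ge0// ltW.
have intf : mu.-integrable `]0, +oo[ (EFin \o f).
  apply: (@ge0_FTC_half_line_integrable _ F f 0 1) => //.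
  - move=> t t0.
    have ? := is_derive1_powR x (ratio0 _ t0).
    have ? := dratio _ t0.
    exact: (@is_derive1_comp _ (fun y => y `^ x) (fun t => t / (1 + t))).
  - move=> t t0; have t1 : 0 < 1 + t by rewrite addr_gt0.
    have [dr _] := dratio _ t0.
    apply: continuousM; [apply: continuousM|].
    + exact: cst_continuous.
    + apply: (@continuous_comp _ _ _ (fun t => t / (1 + t)) (fun y => y `^ (x - 1)));
        last exact: continuous_powR (ratio0 _ t0).
      by apply: differentiable_continuous; apply/derivable1_diffP.
    + apply: continuousV; first by rewrite gt_eqF// exprn_gt0.
      apply: (@continuous_comp _ _ _ (fun t : R => 1 + t) (fun y => y ^+ 2)).
        by apply: cvgD; [exact: cvg_cst|exact: cvg_id].
      exact: exprn_continuous.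
  - apply: (@squeeze_cvgr _ _ _ _ (cst 0) (fun t => t `^ x)).
    + near=> t; have t0 : 0 < t by near: t; exact: nbhs_right_gt.
      rewrite /F powR_ge0/= ge0_ler_powR ?nnegrE ?ltW ?ratio0//.
      by rewrite ltr_pdivrMr ?addr_gt0// ltr_pMr// ltrDl.
    + exact: cvg_cst.
    + exact: powR_cvg0.
  - suff : F t @[t --> +oo%R] --> (1 : R) `^ x by rewrite powR1.
    apply: (@cvg_comp _ _ _ (fun t => t / (1 + t)) (fun y => y `^ x) _ (nbhs (1:R))).
      exact: cvgy_ratio.
    exact: continuous_powR.
apply: (@le_integrable _ _ _ mu _ _ _
   (EFin \o (fun t => ((x + 1) `^ (x + 1) * expR 1 / x) * f t))) => //.
- apply/measurable_EFinP; apply: open_continuous_measurable_fun => // t.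
  by rewrite inE/= in_itv/= andbT => t0; exact: continuous_gamma_kernel.
- move=> t; rewrite /= in_itv/= andbT => t0.
  rewrite lee_fin ger0_norm ?gamma_kernel_ge0// ger0_norm.
    exact: gamma_kernel_le.
  by rewrite mulr_ge0 ?f0// !mulr_ge0 ?powR_ge0 ?expR_ge0// invr_ge0 ltW.
- by have := @integrableZl _ _ _ mu _ (measurable_itv _)
    ((x + 1) `^ (x + 1) * expR 1 / x) _ intf.
Unshelve. all: by end_near. Qed.
End gamma_kernel.

Section gamma.
Variable R : realType.
Notation mu := (@lebesgue_measure R).
Implicit Types (x t a b : R).

Lemma Gamma_gt0E x : 0 < x -> Gamma x = \int[mu]_(t in `]0, +oo[) gamma_kernel x t.
Proof.
move=> x0; rewrite /Gamma /Euler_integral.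
have -> : Num.truncn (1 - x) = 0%N by apply/truncn0Pn; lra.
by rewrite big_ord0 divr1 addr0.
Qed.

Lemma Gamma1 : Gamma (1 : R) = 1.
Proof.
rewrite Gamma_gt0E//; transitivity (0 - -1 : R); last by rewrite sub0r opprK.
apply: (@FTC_half_line _ (fun t => - expR (- t))).
- move=> t t0; rewrite /gamma_kernel subrr powRr0 mul1r.
  by apply: is_derive_eq; rewrite /GRing.scale/=; ring.
- by move=> t t0; exact: continuous_gamma_kernel.
- apply: cvgN; apply: cvg_at_right_filter.
  suff : expR (- t) @[t --> (0 : R)] --> expR (- 0 : R) by rewrite oppr0 expR0.
  exact: continuous_expRN.
- by rewrite -[X in _ --> X]oppr0; apply: cvgN; exact: cvgr_expR.
- exact: integrable_gamma_kernel.
Qed.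

(** Integration by parts in the form: the integral of the derivative of
    t^x e^(-t) vanishes, since that function tends to 0 at 0 and at infinity. *)
Lemma GammaD1 x : 0 < x -> Gamma (x + 1) = x * Gamma x.
Proof.
move=> x0; have x10 : 0 < x + 1 by rewrite addr_gt0.
have ix := integrable_gamma_kernel x0; have ix1 := integrable_gamma_kernel x10.
have ixx : mu.-integrable `]0, +oo[ (EFin \o (fun t => x * gamma_kernel x t)).
  by have := @integrableZl _ _ _ mu _ (measurable_itv _) x _ ix.
rewrite !Gamma_gt0E// -RintegralZl//; apply/esym/eqP; rewrite -subr_eq0.
rewrite -RintegralB//; apply/eqP.
transitivity (0 - 0 : R); last by rewrite subrr.
apply: (@FTC_half_line _ (fun t => t `^ x * expR (- t))).
- move=> t t0; rewrite /gamma_kernel addrK.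
  have ? := is_derive1_powR x t0.
  by apply: is_derive_eq; rewrite /GRing.scale/=; ring.
- move=> t t0; apply: continuousB; last exact: continuous_gamma_kernel.
  by apply: continuousM; [exact: cst_continuous|exact: continuous_gamma_kernel].
- rewrite -[X in _ --> X](mul0r (expR (- 0))); apply: cvgM; first exact: powR_cvg0.
  by apply: cvg_at_right_filter; exact: continuous_expRN.
- apply: (@squeeze_cvgr _ _ _ _ (cst 0) (fun t => (x + 1) `^ (x + 1) * t^-1)).
  + near=> t; have t0 : 0 < t by near: t; exact: nbhs_pinfty_gt.
    rewrite mulr_ge0 ?powR_ge0 ?expR_ge0//= ler_pdivlMr//.
    rewrite mulrAC -{2}(powRr1 (ltW t0)) -powRD; last by rewrite (gt_eqF t0) implybT.
    by rewrite expRN ler_pdivrMr ?expR_gt0// powR_le_expR// ltW.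
  + exact: cvg_cst.
  + rewrite -[X in _ --> X](mulr0 ((x + 1) `^ (x + 1))); apply: cvgM; first exact: cvg_cst.
    apply/gtr0_cvgV0; last exact: cvg_id.
    by near=> t; near: t; exact: nbhs_pinfty_gt.
- by have := @integrableB _ _ _ mu _ (measurable_itv _) _ _ ixx ix1.
Unshelve. all: by end_near. Qed.

Lemma GammaS n : Gamma (n.+1%:R : R) = n`!%:R.
Proof.
elim: n => [|n ih]; first by rewrite Gamma1 fact0.
by rewrite -natr1 GammaD1 ?ltr0n// ih factS natrM.
Qed.

Lemma GammaDn b n : 0 < b -> Gamma (b + n%:R) = (\prod_(i < n) (b + i%:R)) * Gamma b.
Proof.
move=> b0; elim: n => [|n ih]; first by rewrite addr0 big_ord0 mul1r.
rewrite -natr1 addrA GammaD1; last by rewrite ltr_wpDr.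
by rewrite ih big_ord_recr/= mulrA (mulrC (b + _)).
Qed.

(** s^b >= t^b (1 + b ln (s/t)) by convexity of the exponential, and
    ln (s/t) >= 1 - t/s. The bound is linear in 1/s, so that its product with a
    Gamma kernel integrates to values of Gamma. *)
Lemma powR_tangent b s t : 0 <= b -> 0 < s -> 0 < t ->
  t `^ b * (1 + b - b * t / s) <= s `^ b.
Proof.
move=> b0 s0 t0; have st0 : 0 < s / t by rewrite divr_gt0.
have -> : s `^ b = t `^ b * (s / t) `^ b.
  rewrite -powRM ?ltW//; congr (_ `^ _).
  by field; rewrite gt_eqF.
rewrite ler_wpM2l ?powR_ge0//.
rewrite /powR gt_eqF//; apply: le_trans (expR_ge1Dx _).
rewrite -addrA lerD2l -{1}(mulr1 b) -mulrA -mulrBr ler_wpM2l//.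
have := @le_ln1Dx R (t / s - 1); rewrite subrKC.
have ts0 : 0 < t / s by rewrite divr_gt0.
rewrite ltrBrDl subrr => /(_ ts0).
by rewrite -[s / t]invf_div lnV ?posrE//; lra.
Qed.

(** The integral of the previous inequality against s^(x-1) e^(-s). It plays the
    part of the log-convexity of Gamma: it gives the sign of the Caputo error
    and the positivity of Psi(m+1) - ln T. *)
Lemma Gamma_tangent x b t : 1 < x -> 0 <= b -> 0 < t ->
  t `^ b * ((1 + b) * Gamma x - b * t * Gamma (x - 1)) <= Gamma (x + b).
Proof.
move=> x1 b0 t0.
have x0 : 0 < x by lra.
have x10 : 0 < x - 1 by lra.
have xb0 : 0 < x + b by lra.
have i1 := integrable_gamma_kernel x0; have i2 := integrable_gamma_kernel x10.
have i3 := integrable_gamma_kernel xb0.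
have intZ k (f : R -> R) : mu.-integrable `]0, +oo[ (EFin \o f) ->
    mu.-integrable `]0, +oo[ (EFin \o (fun t => k * f t)).
  by move=> /(@integrableZl _ _ _ mu _ (measurable_itv _) k).
have i4 := intZ (1 + b) _ i1; have i5 := intZ (b * t) _ i2.
have i6 : mu.-integrable `]0, +oo[ (EFin \o
    (fun s => (1 + b) * gamma_kernel x s - b * t * gamma_kernel (x - 1) s)).
  by have := @integrableB _ _ _ mu _ (measurable_itv _) _ _ i4 i5.
rewrite !Gamma_gt0E// -!RintegralZl// -RintegralB// -RintegralZl//.
apply: le_Rintegral => //; first exact: intZ.
move=> s; rewrite /= in_itv/= andbT => s0.
have -> : gamma_kernel x s = s * gamma_kernel (x - 1) s.
  by rewrite /gamma_kernel mulrA mulr_powRB1// ltW.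
have -> : gamma_kernel (x + b) s = s * s `^ b * gamma_kernel (x - 1) s.
  have s1 : s = s `^ 1 by rewrite powRr1// ltW.
  rewrite /gamma_kernel mulrA {3}s1 -!powRD ?(gt_eqF s0) ?implybT//.
  by congr (_ `^ _ * _); ring.
have := powR_tangent b0 s0 t0; have := gamma_kernel_ge0 (x - 1) s.
move: (gamma_kernel _ _) => k k0 h.
have -> : t `^ b * ((1 + b) * (s * k) - b * t * k) =
    t `^ b * (1 + b - b * t / s) * (s * k).
  by field; rewrite gt_eqF.
rewrite (_ : s * s `^ b * k = s `^ b * (s * k)); last by ring.
apply: ler_wpM2r => //.
by rewrite mulr_ge0// ltW.
Qed.

(** Any small power dominates the logarithm: ln u <= u at u = t^s and at
    u = t^(-s). *)
Lemma norm_ln_le s t : 0 < s -> 0 < t -> `|ln t| <= s^-1 * (t `^ s + t `^ (- s)).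
Proof.
move=> s0 t0; rewrite ler_pdivlMl//.
have ps := powR_gt0 s t0; have pN := powR_gt0 (- s) t0.
have lep (u : R) : 0 < u -> ln u <= u by move=> u0; exact: ltW (ln_sublinear u0).
have := lep _ ps; have := lep _ pN; rewrite !ln_powR.
have -> : s * `|ln t| = `|s * ln t| by rewrite normrM gtr0_norm.
rewrite ler_norml => h1 h2; apply/andP; split; lra.
Qed.

Lemma powR_le_endpoints a b c t : a <= c <= b -> 0 < t ->
  t `^ c <= t `^ a + t `^ b.
Proof.
move=> /andP[ac cb] t0; have [t1|/ltW t1] := leP t 1.
  by apply: le_trans (_ : t `^ a <= _); rewrite ?lerDl ?powR_ge0// ger_powR// t0.
by apply: le_trans (_ : t `^ b <= _); rewrite ?lerDr ?powR_ge0// ler_powR.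
Qed.

Lemma is_derive_gamma_kernel x t : 0 < t ->
  is_derive x 1 (fun y => gamma_kernel y t) (ln t * gamma_kernel x t).
Proof.
move=> t0.
have -> : (fun y => gamma_kernel y t) = fun y => expR ((y - 1) * ln t) * expR (- t).
  by apply/funext => y; rewrite /gamma_kernel /powR gt_eqF.
rewrite /gamma_kernel /powR gt_eqF//.
by apply: is_derive_eq; rewrite /GRing.scale/=; ring.
Qed.

(** Differentiation under the integral sign. For x between a/2 and 2a, the
    derivative ln t t^(x-1) e^(-t) of the kernel is dominated by a combination
    of the four kernels of parameters a/2 +- s and 2a +- s; the choice s = a/4
    keeps all four parameters positive. *)
Lemma derivable_Gamma a : 0 < a -> derivable (@Gamma R) a 1.
Proof.
move=> a0.
have Iy y : y \in `](a / 2), (2 * a)[ -> 0 < y.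
  by rewrite in_itv/= => /andP[+ _]; apply: le_lt_trans; rewrite divr_ge0// ltW.
apply: (@near_eq_derivable _ _ _ (fun x => \int[mu]_(t in `]0, +oo[) gamma_kernel x t)).
  have : a \in `](a / 2), (2 * a)[ by rewrite in_itv/=; apply/andP; split; lra.
  move=> /near_in_itvoo; apply: filterS => y /Iy y0.
  by rewrite Gamma_gt0E.
pose s := a / 4.
pose p : R := a / 2; pose q := 2 * a.
pose G t := s^-1 * (((gamma_kernel (p + s) t + gamma_kernel (p - s) t) +
  (gamma_kernel (q + s) t + gamma_kernel (q - s) t))).
have s0 : 0 < s by rewrite divr_gt0.
have ps0 : 0 < p + s by rewrite addr_gt0// divr_gt0.
have pNs0 : 0 < p - s by rewrite (_ : p - s = s)// /p /s; field.
have qs0 : 0 < q + s by rewrite addr_gt0// mulr_gt0.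
have qNs0 : 0 < q - s by rewrite (_ : q - s = 7 * s) ?mulr_gt0// /q /s; field.
apply: (@derivable_under_integral _ _ _ mu _ _ (measurable_itv _) _ p q _ _ _ G).
- by rewrite /= in_itv/= /p /q; apply/andP; split; lra.
- by move=> x /Iy x0; exact: integrable_gamma_kernel.
- move=> x t _; rewrite /= in_itv/= andbT => t0.
  by case: (is_derive_gamma_kernel x t0).
- by move=> t; rewrite mulr_ge0 ?invr_ge0 ?(ltW s0)// !addr_ge0// gamma_kernel_ge0.
- have iD f g : mu.-integrable `]0, +oo[ (EFin \o f) ->
      mu.-integrable `]0, +oo[ (EFin \o g) ->
      mu.-integrable `]0, +oo[ (EFin \o (fun t : R => f t + g t)).
    by move=> fi /(@integrableD _ _ _ mu _ (measurable_itv _) _ _ fi).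
  apply: (@integrableZl _ _ _ mu _ (measurable_itv _) s^-1 (EFin \o _)).
  by apply: (iD) => //; apply: iD => //; exact: integrable_gamma_kernel.
- move=> x t; rewrite /= in_itv/= => /andP[px xq]; rewrite in_itv/= andbT => t0.
  rewrite partial1of2E; have [_ ->] := is_derive_gamma_kernel x t0.
  rewrite normrM (ger0_norm (gamma_kernel_ge0 _ _)).
  have h1 := norm_ln_le s0 t0.
  have h2 : t `^ (x - 1) <= t `^ (p - 1) + t `^ (q - 1).
    by apply: powR_le_endpoints => //; apply/andP; split; lra.
  have Gsplit z : gamma_kernel (z + s) t + gamma_kernel (z - s) t =
      (t `^ s + t `^ (- s)) * (t `^ (z - 1) * expR (- t)).
    rewrite /gamma_kernel mulrDl !mulrA -!powRD ?(gt_eqF t0) ?implybT//.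
    by congr (_ `^ _ * _ + _ `^ _ * _); ring.
  have -> : G t = s^-1 * (t `^ s + t `^ (- s)) *
      ((t `^ (p - 1) + t `^ (q - 1)) * expR (- t)) by rewrite /G !Gsplit; ring.
  apply: ler_pM => //; first exact: gamma_kernel_ge0.
  rewrite /gamma_kernel.
  by rewrite ler_wpM2r ?expR_ge0.
Qed.
End gamma.

(** * A beta integral *)

Section beta_integral.
Variable R : realType.
Notation mu := (@lebesgue_measure R).
Variable t : R.
Hypothesis t0 : 0 < t.
Implicit Types (n : nat) (a s : R).

(** A primitive of s^n (t - s)^(a-1), from repeated integrations by parts that
    lower n and raise a. *)
Fixpoint beta_primitive n a s : R :=
  if n is n'.+1 then
    a^-1 * (n%:R * beta_primitive n' (a + 1) s - s ^+ n * (t - s) `^ a)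
  else - (a^-1 * (t - s) `^ a).

Lemma is_derive_powRB a s : s < t ->
  is_derive s 1 (fun s => (t - s) `^ a) (- (a * (t - s) `^ (a - 1))).
Proof.
move=> st; have ts0 : 0 < t - s by rewrite subr_gt0.
have ? := is_derive1_powR a ts0.
have ? : is_derive s 1 (fun s => t - s) (- 1) by apply: is_derive_eq; ring.
rewrite -[X in is_derive _ _ _ X]mulrN1.
exact: (@is_derive1_comp _ (fun y => y `^ a) (fun s => t - s)).
Qed.

Lemma is_derive_beta_primitive n a s : 0 < a -> s < t ->
  is_derive s 1 (beta_primitive n a) (s ^+ n * (t - s) `^ (a - 1)).
Proof.
elim: n a => [|n ih] a a0 st /=.
  have ? := is_derive_powRB a st.
  by apply: is_derive_eq; rewrite /GRing.scale/= expr0; field; rewrite gt_eqF.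
have ? := is_derive_powRB a st.
have a10 : 0 < a + 1 by rewrite addr_gt0.
have ? := ih _ a10 st.
apply: is_derive_eq; rewrite /GRing.scale/= addrK exprS.
by field; rewrite gt_eqF.
Qed.

(** Each term of the primitive has a factor (t - s) to a positive power, hence
    it vanishes at the singular endpoint. The statement uses a sequence since
    that is the form in which the exhaustion meets the endpoint. *)
Lemma cvg_beta_primitive n a (w : nat -> R) : 0 < a ->
  w k @[k --> \oo] --> t ->
  (forall a, 0 < a -> (t - w k) `^ a @[k --> \oo] --> 0) ->
  beta_primitive n a (w k) @[k --> \oo] --> 0.
Proof.
move=> + wt wp; elim: n a => [|n ih] a a0 /=.
  rewrite -oppr0 -(mulr0 a^-1); apply: cvgN; apply: cvgM; first exact: cvg_cst.
  exact: wp.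
rewrite -(mulr0 a^-1); apply: cvgM; first exact: cvg_cst.
have -> : 0 = n.+1%:R * 0 - t ^+ n.+1 * 0 :> R by ring.
apply: cvgB; apply: cvgM.
- exact: cvg_cst.
- by apply: ih; rewrite addr_gt0.
- by apply: (@continuous_cvg _ _ _ _ _ _ (fun x : R => x ^+ n.+1)) => //; exact: exprn_continuous.
- exact: wp.
Qed.

Lemma beta_primitive0 n a : 0 < a ->
  beta_primitive n a 0 = - (n`!%:R / (\prod_(i < n.+1) (a + i%:R)) * t `^ (n%:R + a)).
Proof.
elim: n a => [|n ih] a a0 /=.
  by rewrite subr0 big_ord_recl big_ord0 mulr1 addr0 fact0 mul1r add0r.
have a10 : 0 < a + 1 by rewrite addr_gt0.
rewrite ih// [in RHS]big_ord_recl/= expr0n/= mul0r subr0 addr0.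
rewrite (_ : n%:R + (a + 1) = n.+1%:R + a); last by rewrite -natr1; ring.
rewrite factS natrM (eq_bigr (fun i : 'I_n.+1 => a + (lift ord0 i)%:R)); last first.
  by move=> i _; rewrite lift0 -natr1 -addrA (addrC 1).
field; rewrite [in X in X && _]gt_eqF ?[in X in _ && X]gt_eqF//.
by apply: prodr_gt0 => i _; rewrite ltr_wpDr.
Qed.

(* The segments [0, t - t/(k+1)] exhaust [0, t[. *)
Section exhaustion_data.
Variables (n : nat) (a : R).
Hypothesis a0 : 0 < a.
Let u (k : nat) : R := 0.
Let v (k : nat) : R := t - t * k.+1%:R^-1.
Let f s := s ^+ n * (t - s) `^ (a - 1).

Let uN : {homo u : i j / (i <= j)%N >-> j <= i}.
Proof. by []. Qed.

Let vN : {homo v : i j / (i <= j)%N >-> i <= j}.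
Proof.
move=> i j ij; rewrite lerD2l lerN2 ler_pM2l// lef_pV2 ?posrE ?ltr0n//.
by rewrite ler_nat.
Qed.

Let uv k : u k <= v k.
Proof. by rewrite subr_ge0 ger_pMr// invf_le1 ?ltr0n// ler1n. Qed.

Let DE : `[0, t[%classic = \bigcup_k `[u k, v k]%classic.
Proof.
apply/seteqP; split => x /=; last first.
  case=> k _ /=; rewrite !in_itv/= => /andP[-> xv]/=.
  by rewrite (le_lt_trans xv)// ltrBlDr ltrDl mulr_gt0// invr_gt0 ltr0n.
rewrite in_itv/= => /andP[x0 xt].
exists (Num.truncn (t / (t - x))) => //=; rewrite in_itv/= x0/=.
have tx0 : 0 < t - x by rewrite subr_gt0.
have := truncnS_gt (t / (t - x)); move: (Num.truncn _) => k.
rewrite ltr_pdivrMr// => h.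
rewrite /v lerBrDr -lerBrDl ler_pdivrMr ?ltr0n//.
by rewrite mulrC ltW.
Qed.

Let Dlt (x : R) : `[0, t[%classic x -> x < t.
Proof. by rewrite /= in_itv/= => /andP[]. Qed.

Let dF (x : R) : `[0, t[%classic x -> is_derive x 1 (beta_primitive n a) (f x).
Proof. by move=> /Dlt; exact: is_derive_beta_primitive. Qed.

Let cf (x : R) : `[0, t[%classic x -> {for x, continuous f}.
Proof.
move=> /Dlt xt; apply: continuousM; first exact: exprn_continuous.
apply: differentiable_continuous; apply/derivable1_diffP.
by case: (is_derive_powRB (a - 1) xt).
Qed.

Let Fl : beta_primitive n a (v k) - beta_primitive n a (u k) @[k --> \oo] -->
  n`!%:R / (\prod_(i < n.+1) (a + i%:R)) * t `^ (n%:R + a).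
Proof.
have -> : n`!%:R / (\prod_(i < n.+1) (a + i%:R)) * t `^ (n%:R + a) =
    0 - beta_primitive n a 0 by rewrite beta_primitive0// sub0r opprK.
apply: cvgB; last by rewrite /u; exact: cvg_cst.
have h0 : t * k.+1%:R^-1 @[k --> \oo] --> (0 : R).
  by rewrite -(mulr0 t); apply: cvgM; [exact: cvg_cst|exact: cvg_harmonic].
apply: cvg_beta_primitive => //.
  rewrite -[X in _ --> X]subr0; apply: cvgB => //; exact: cvg_cst.
move=> b b0.
under eq_fun do rewrite /v opprB addrC subrK.
apply: ((cvg_at_rightP (fun x : R => x `^ b) 0 0).1 (powR_cvg0 b0)); split => //.
by move=> k; rewrite mulr_gt0// invr_gt0 ltr0n.
Qed.

Let f0 (x : R) : `[0, t[%classic x -> 0 <= f x.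
Proof.
by rewrite /= in_itv/= => /andP[x0 _]; rewrite mulr_ge0 ?exprn_ge0 ?powR_ge0.
Qed.

(** Euler's beta integral with one integer parameter; the product in the
    denominator is Gamma (a + n + 1) / Gamma a. *)
Lemma Rintegral_beta :
  \int[mu]_(s in `[0, t]) (s ^+ n * (t - s) `^ (a - 1)) =
  n`!%:R / (\prod_(i < n.+1) (a + i%:R)) * t `^ (n%:R + a).
Proof.
rewrite -Rintegral_itv_bndo_bndc.
  by rewrite /Rintegral (ge0_FTC_exhaustion uN vN uv DE dF cf Fl).
exact: (ge0_FTC_exhaustion_integrable uN vN uv DE dF cf Fl).
Qed.

Lemma integrable_beta :
  mu.-integrable `[0, t[ (EFin \o (fun s => s ^+ n * (t - s) `^ (a - 1))).
Proof. exact: (ge0_FTC_exhaustion_integrable uN vN uv DE dF cf Fl). Qed.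

End exhaustion_data.
End beta_integral.

(** * Convolution of monomials with an exponential *)

Section exponential_convolution.
Variable R : realType.
Notation mu := (@lebesgue_measure R).
Implicit Types (n : nat) (c s t : R).

(** The convolution of t^n with e^(-ct), computed by the recurrence that
    integration by parts gives. It is the solution of y' = t^n - c y with
    y 0 = 0, and it is only used through this equation. *)
Fixpoint exp_conv c n t : R :=
  if n is n'.+1 then c^-1 * (t ^+ n - n%:R * exp_conv c n' t)
  else c^-1 * (1 - expR (- (c * t))).

Lemma exp_conv0 c n : exp_conv c n 0 = 0.
Proof.
case: n => [|n] /=; first by rewrite mulr0 oppr0 expR0 subrr mulr0.
elim: n => [|n ih] /=; first by rewrite mulr0 oppr0 expR0 subrr expr0n/= !mulr0 subrr mulr0.
by rewrite ih expr0n/= mulr0 subrr mulr0.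
Qed.

Lemma is_derive_exp_conv c n t : c != 0 ->
  is_derive t 1 (exp_conv c n) (t ^+ n - c * exp_conv c n t).
Proof.
move=> c0; elim: n => [|n ih] /=.
  by apply: is_derive_eq; rewrite /GRing.scale/= expr0; field.
by apply: is_derive_eq; rewrite /GRing.scale/=; field.
Qed.

Lemma Rintegral_exp_conv c n t : c != 0 -> 0 <= t ->
  \int[mu]_(s in `[0, t]) (s ^+ n * expR (- c * (t - s))) = exp_conv c n t.
Proof.
move=> c0 t0; pose F s := exp_conv c n s * expR (- c * (t - s)).
transitivity (F t - F 0); last first.
  by rewrite /F subrr mulr0 expR0 mulr1 exp_conv0 mul0r subr0.
apply: Rintegral_FTC_within => //; rewrite {}/F.
- move=> s _; have ? := is_derive_exp_conv n s c0.
  by apply: is_derive_eq; rewrite /GRing.scale/=; ring.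
- move=> s _; apply: continuous_is_derive.
Qed.

(** The equation y' = t^n - c y integrated over [0, t]; this replaces an
    exchange of the order of integration. *)
Lemma Rintegral_of_exp_conv c n t : c != 0 -> 0 <= t ->
  \int[mu]_(s in `[0, t]) exp_conv c n s =
  c^-1 * (t ^+ n.+1 / n.+1%:R - exp_conv c n t).
Proof.
move=> c0 t0; pose F s := c^-1 * (s ^+ n.+1 / n.+1%:R - exp_conv c n s).
transitivity (F t - F 0); last first.
  by rewrite /F exp_conv0 expr0n/= mul0r subr0 mulr0 subr0.
apply: Rintegral_FTC_within => //; rewrite {}/F.
- move=> s _; have ? := is_derive_exp_conv n s c0.
  apply: is_derive_eq; rewrite /GRing.scale/=; field.
  by rewrite c0 addrC natr1 pnatr_eq0.
- move=> s _; exact: continuous_is_derive (is_derive_exp_conv n s c0).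
Qed.

(** A comparison of b t^(n+1) with the solution y of y' + c y = t^(n+1), where
    c = (1 - b)/b. Multiplied by e^(ct), the difference b t^(n+1) - y has the
    derivative b t^n (n + 1 - t) e^(ct), which is nonnegative exactly up to
    n + 1: here the bound on T enters. *)
Lemma exp_conv_le (b t : R) n : 0 < b < 1 -> 0 <= t <= n.+1%:R ->
  exp_conv ((1 - b) / b) n.+1 t <= b * t ^+ n.+1.
Proof.
move=> /andP[b0 b1] /andP[t0 tn].
set c := (1 - b) / b.
have c0 : 0 < c by rewrite divr_gt0// subr_gt0.
pose h s := (b * s ^+ n.+1 - exp_conv c n.+1 s) * expR (c * s).
pose h' s := b * s ^+ n * (n.+1%:R - s) * expR (c * s).
have dh s : is_derive s 1 h (h' s).
  have dy := is_derive_exp_conv n.+1 s (lt0r_neq0 c0).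
  rewrite /h /h'; move: (exp_conv c n.+1) dy => y dy.
  apply: is_derive_eq; rewrite /GRing.scale/= exprS /c.
  by field; rewrite gt_eqF.
have : (0 <= \int[mu]_(s in `[0%R, t]) (h' s)%:E)%E.
  apply: integral_ge0 => s; rewrite /= in_itv/= => /andP[s0 st].
  rewrite lee_fin !mulr_ge0 ?expR_ge0 ?exprn_ge0 ?(ltW b0)// subr_ge0.
  exact: le_trans tn.
rewrite (@FTC_within _ h)//; last first.
  move=> s _; rewrite /h'; apply: continuousM; last first.
    by apply: continuous_is_derive; apply: is_derive_eq.
  by apply: continuous_is_derive.
rewrite lee_fin {2}/h exp_conv0 expr0n/= mulr0 subrr mul0r subr0.
by rewrite /h pmulr_lge0 ?expR_gt0// subr_ge0.
Qed.

(** The recurrence carries a factor 1/c = b/(1 - b), which tends to 0. *)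
Lemma cvg_exp_conv n t : 0 <= t ->
  exp_conv ((1 - b) / b) n t @[b --> 0^'+] --> (0 : R).
Proof.
move=> t0.
have cV0 : ((1 - b) / b)^-1 @[b --> 0^'+] --> (0 : R).
  have <- : (fun b => b / (1 - b)) = (fun b : R => ((1 - b) / b)^-1).
    by apply/funext => b; rewrite invf_div.
  rewrite -[X in _ --> X](mul0r ((1 - 0)^-1)); apply: cvgM.
    by apply: cvg_at_right_filter; exact: cvg_id.
  apply: cvgV; first by rewrite subr0.
  apply: cvgB; first exact: cvg_cst.
  by apply: cvg_at_right_filter; exact: cvg_id.
elim: n => [|n ih] /=; last first.
  rewrite -[X in _ --> X](mul0r (t ^+ n.+1 - n.+1%:R * 0)); apply: cvgM => //.
  apply: cvgB; first exact: cvg_cst.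
  by apply: cvgM; first exact: cvg_cst.
apply: (@squeeze_cvgr _ _ _ _ (cst 0) (fun b => ((1 - b) / b)^-1)) => //; last exact: cvg_cst.
near=> b; have b0 : 0 < b by near: b; exact: nbhs_right_gt.
have b1 : b < 1 by near: b; exact: nbhs_right_lt.
have c0 : 0 < (1 - b) / b by rewrite divr_gt0// subr_gt0.
rewrite pmulr_rge0 ?invr_gt0// subr_ge0 expR_le1 oppr_le0 mulr_ge0 ?(ltW c0)//=.
by rewrite ger_pMr ?invr_gt0// lerBlDr lerDl expR_ge0.
Unshelve. all: by end_near. Qed.
End exponential_convolution.

(** * Smooth bumps *)

Section bump.
Variable R : realType.
Variables a b c : R.
Hypothesis ab : a < b.
Hypothesis c0 : 0 < c.
Implicit Types (x y : R) (k n : nat) (p : {poly R}).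

Let w x := ((x - a) * (b - x))^-1.

(** For k = 0 a smooth bump supported on [a, b]. The powers w^k are there since
    every derivative of the bump is a combination of these functions with
    polynomial coefficients. *)
Definition bump k x : R :=
  if a < x < b then w x ^+ k * expR (- (c * w x)) else 0.

Lemma bump_ge0 k x : 0 <= bump k x.
Proof.
rewrite /bump; case: ifPn => // /andP[ax xb].
by rewrite mulr_ge0 ?expR_ge0// exprn_ge0// invr_ge0 mulr_ge0// subr_ge0 ltW.
Qed.

(** y^(k+2) <= (k+2)! e^y at y = c w: the exponential beats k + 2 powers of w,
    which leaves a double zero at a and at b. *)
Lemma bump_le_sqr k x : bump k x <= k.+2`!%:R / c ^+ k.+2 * ((x - a) * (b - x)) ^+ 2.
Proof.
set C := _ / _; have C0 : 0 <= C by rewrite divr_ge0// exprn_ge0// ltW.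
rewrite /bump; case: ifPn => [/andP[ax xb]|_]; last by rewrite mulr_ge0// sqr_ge0.
have u0 : 0 < (x - a) * (b - x) by rewrite mulr_gt0// subr_gt0.
rewrite -[(x - a) * _]invrK -/(w x); have : 0 < w x by rewrite invr_gt0.
move: (w x) => y y0; rewrite exprVn ler_pdivlMr ?exprn_gt0// mulrAC -exprD addn2.
have cy0 : 0 <= c * y by rewrite mulr_ge0// ltW.
have h : (c * y) ^+ k.+2 / k.+2`!%:R <= expR (c * y).
  by apply: le_trans (expR_ge1Dxn k.+1 cy0); rewrite lerDr.
rewrite expRN ler_pdivrMr ?expR_gt0// /C mulrAC ler_pdivlMr ?exprn_gt0//.
move: h; rewrite ler_pdivrMr ?ltr0n ?fact_gt0// exprMn (mulrC (expR _)).
by rewrite (mulrC (_ ^+ _)).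
Qed.

Lemma is_derive_flat (f : R -> R) x (C : R) :
  f x = 0 -> (forall y, `|f y| <= C * (y - x) ^+ 2) -> is_derive x 1 f 0.
Proof.
move=> fx0 fC.
have h : h^-1 *: (f (h + x) - f x) @[h --> 0^'] --> (0 : R).
  apply: norm_cvg0.
  apply: (@squeeze_cvgr _ _ _ _ (cst 0) (fun h => C * `|h|)).
  - near=> h; have h0 : h != 0 by near: h; exact: nbhs_dnbhs_neq.
    rewrite normr_ge0/= fx0 subr0 normrZ normfV.
    rewrite ler_pdivrMl ?normr_gt0//.
    apply: le_trans (fC _) _.
    by rewrite addrK -[h ^+ 2]ger0_norm ?sqr_ge0// normrX expr2 mulrCA.
  - exact: cvg_cst.
  - rewrite -[X in _ --> X](mulr0 C); apply: cvgM; first exact: cvg_cst.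
    rewrite -[X in _ --> X](normr0 R); apply: cvg_norm.
    exact: cvg_within_filter.
apply: DeriveDef.
  apply/cvg_ex; exists 0; apply: cvg_trans h; apply: near_eq_cvg; near=> h.
  by rewrite /GRing.scale/= mulr1.
rewrite -derive1E; exact: cvg_lim h.
Unshelve. all: by end_near. Qed.

(** Inside ]a, b[ this is calculus. Outside, the endpoints included, the double
    zero of the bump makes the derivative vanish; both cases give one formula,
    because the right-hand side vanishes there too. *)
Lemma is_derive_bump k x :
  is_derive x 1 (bump k) ((a + b - 2 * x) * (c * bump k.+2 x - k%:R * bump k.+1 x)).
Proof.
have [|xab] := boolP (a < x < b); last first.
  rewrite {2 3}/bump (negbTE xab) !mulr0 subrr mulr0.
  (* The constant of bump_le_sqr; the factor of (x - a) (b - x) that does not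
     measure the distance to x is at most b - a. *)
  pose C := k.+2`!%:R / c ^+ k.+2.
  have C0 : 0 <= C by rewrite divr_ge0// exprn_ge0// ltW.
  apply: (@is_derive_flat _ _ (C * (b - a) ^+ 2)); first by rewrite /bump (negbTE xab).
  move=> y; have [/andP[ay yb]|yab] := boolP (a < y < b); last first.
    by rewrite /bump (negbTE yab) normr0 mulr_ge0 ?sqr_ge0// mulr_ge0 ?sqr_ge0.
  rewrite ger0_norm ?bump_ge0//; apply: le_trans (bump_le_sqr _ _) _.
  rewrite -/C -(mulrA C) -exprMn; apply: ler_wpM2l => //.
  rewrite -[leRHS]real_normK ?num_real// lerXn2r ?nnegrE//.
    by rewrite mulr_ge0// subr_ge0 ltW.
  rewrite normrM (ger0_norm (ltW _)) ?subr_gt0//.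
  move: xab; rewrite negb_and -!leNgt => /orP[xa|bx].
    rewrite mulrC; apply: ler_pM; rewrite ?subr_ge0 ?(ltW ay) ?(ltW yb)//.
      by rewrite lerD2l lerN2 ltW.
    by apply: le_trans (ler_norm _); rewrite lerD2l lerN2.
  apply: ler_pM; rewrite ?subr_ge0 ?(ltW ay) ?(ltW yb)//.
    by rewrite lerD2r ltW.
  by rewrite distrC; apply: le_trans (ler_norm _); rewrite lerD2r.
move=> xab; have /andP[ax xb] := xab.
have u0 : (x - a) * (b - x) != 0 by rewrite gt_eqF// mulr_gt0// subr_gt0.
have dw : is_derive x 1 w (- (a + b - 2 * x) * w x ^+ 2).
  have du : is_derive x 1 (fun x => (x - a) * (b - x)) (a + b - 2 * x).
    by apply: is_derive_eq; rewrite /GRing.scale/=; ring.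
  have := @is_deriveV _ (fun x => (x - a) * (b - x)) x _ _ u0 du; rewrite /GRing.scale/= exprVn.
  by rewrite mulrC mulNr -mulrN.
apply: (@near_eq_is_derive _ _ _ (fun x => w x ^+ k * expR (- (c * w x)))).
  have : x \in `]a, b[ by rewrite in_itv.
  by move=> /near_in_itvoo; apply: filterS => y; rewrite in_itv/= /bump => ->.
rewrite /bump xab; move: w dw => v dv.
have dX : is_derive x 1 (fun y => v y ^+ k)
    (k%:R * v x ^+ k.-1 * (- (a + b - 2 * x) * v x ^+ 2)).
  exact: (@is_derive1_comp _ (fun y => y ^+ k) v).
apply: is_derive_eq; rewrite /GRing.scale/=.
case: k {dX} => [|k]/=; rewrite ?expr0 ?exprS; ring.
Qed.

(** A class of functions closed under differentiation, so that its elements have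
    derivatives of all orders without any formula for the nth one. *)
Inductive bump_span : (R -> R) -> Prop :=
| bump_span_mul p k : bump_span (fun x => p.[x] * bump k x)
| bump_span_add f g : bump_span f -> bump_span g -> bump_span (fun x => f x + g x).

Lemma bump_span_derive f : bump_span f ->
  exists2 g, bump_span g & forall x, is_derive x 1 f (g x).
Proof.
elim=> [p k|{}f g _ [f' sf' df] _ [g' sg' dg]]; last first.
  exists (fun x => f' x + g' x); first exact: bump_span_add.
  by move=> x; have ? := df x; have ? := dg x; exact: is_deriveD.
pose q : {poly R} := p * ((a + b)%:P - 2%:R *: 'X).
exists (fun x => p^`().[x] * bump k x +
  ((c *: q).[x] * bump k.+2 x + (- k%:R *: q).[x] * bump k.+1 x)).
  by do 2! (apply: bump_span_add; first exact: bump_span_mul);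
    exact: bump_span_mul.
move=> x; have ? := is_derive_bump k x.
apply: is_derive_eq; rewrite /GRing.scale/= /q.
by rewrite !(hornerZ, hornerM, hornerD, hornerN, hornerC, hornerX); ring.
Qed.

Lemma bump_span_derive1n f n : bump_span f -> bump_span f^`(n)%classic.
Proof.
move=> sf; elim: n => [|n /bump_span_derive[g sg dg]]; first by rewrite derive1n0.
rewrite derive1nS; suff -> : (f^`(n)%classic)^`()%classic = g by [].
by apply/funext => x; rewrite derive1E; case: (dg x).
Qed.

Lemma test_function_bump (T : R) : 0 < a -> b < T -> test_function T (bump 0).
Proof.
move=> a0 bT; split.
  move=> n x; have : bump_span (bump 0).
    rewrite (_ : bump 0 = fun x => 1%:P.[x] * bump 0 x).
      exact: bump_span_mul.
    by apply/funext => y; rewrite hornerC mul1r.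
  by move=> /(@bump_span_derive1n _ n)/bump_span_derive[g _ /(_ x)[]].
exists `[a, b]%classic; split; first exact: segment_compact.
  move=> x; rewrite /= !in_itv/= => /andP[ax xb].
  by rewrite (lt_le_trans a0 ax) (le_lt_trans xb bT).
move=> x; rewrite /= in_itv/= => /negP xab; rewrite /bump ifN//.
by apply: contra xab => /andP[/ltW -> /ltW ->].
Qed.

Lemma bump0_le1 x : bump 0 x <= 1.
Proof.
rewrite /bump; case: ifPn => // /andP[ax xb].
rewrite expr0 mul1r expR_le1 oppr_le0 mulr_ge0 ?(ltW c0)//.
by rewrite invr_ge0 mulr_ge0// subr_ge0 ltW.
Qed.

End bump.

(** * Uniqueness of the weak derivative *)

Section weak_derivative.
Variable R : realType.
Notation mu := (@lebesgue_measure R).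
Variable T : R.
Implicit Types (f g h k : R -> R).

Lemma integrable_mul_bounded (D : set R) f h : measurable D ->
  mu.-integrable D (EFin \o f) -> measurable_fun D h ->
  (exists M, forall x, D x -> `|h x| <= M) ->
  mu.-integrable D (EFin \o (fun x => f x * h x)).
Proof.
move=> mD intf mh [M hM].
have mf : measurable_fun D f by apply/measurable_EFinP; exact: (measurable_int mu intf).
apply: (@le_integrable _ _ _ mu _ mD _ (EFin \o (fun x => M * `|f x|))).
- by apply/measurable_EFinP; exact: measurable_funM.
- move=> x Dx; rewrite lee_fin normrM mulrC [leRHS]ger0_norm ?ler_wpM2r ?hM//.
  by rewrite mulr_ge0// (le_trans _ (hM _ Dx)).
- by have := @integrableZl _ _ _ mu _ mD M _ (integrable_norm intf).
Qed.

Section fundamental_lemma.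
Variable k : R -> R.
Hypothesis intk : mu.-integrable `]0, T[ (EFin \o k).
Hypothesis k_test : forall phi, test_function T phi ->
  \int[mu]_(x in `]0, T[) (k x * phi x) = 0.

(** The bumps exp (- w/(n+1)) are test functions bounded by 1 that converge to
    the indicator of ]a, b[; dominated convergence does the rest. *)
Lemma Rintegral_test0_itv a b : 0 < a -> a < b -> b < T ->
  \int[mu]_(x in `]a, b[) k x = 0.
Proof.
move=> a0 ab bT.
pose c n : R := n.+1%:R^-1.
have cp n : 0 < c n by rewrite invr_gt0 ltr0n.
pose phi n := bump a b (c n) 0.
have tphi n : test_function T (phi n) by exact: test_function_bump.
have phi1 n x : `|phi n x| <= 1 by rewrite ger0_norm ?bump_ge0// bump0_le1.
have cphi n : continuous (phi n).
  move=> x; exact: continuous_is_derive (is_derive_bump ab (cp n) 0 x).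
have mphi n (D : set R) : measurable D -> measurable_fun D (phi n).
  by move=> mD; apply: measurable_funTS; exact: continuous_measurable_fun.
have mD : measurable (`]0, T[%classic : set R) by exact: measurable_itv.
have mk : measurable_fun `]0, T[ k by apply/measurable_EFinP; exact: (measurable_int mu intk).
have abT : `]a, b[%classic `<=` `]0, T[%classic.
  by apply: subset_itv; rewrite bnd_simp ltW.
have intkphi n : mu.-integrable `]0, T[ (EFin \o (fun x => k x * phi n x)).
  by apply: integrable_mul_bounded => //; [exact: mphi|exists 1].
have := @dominated_convergence _ _ _ mu _ mD
  (fun n x => (k x * phi n x)%:E) ((EFin \o k) \_ `]a, b[) (EFin \o (fun x => `|k x|)).
case=> //.
- by move=> n; apply/measurable_EFinP; apply: measurable_funM => //; exact: mphi.
- apply/(measurable_restrict _ (measurable_itv _) mD).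
  by apply/measurable_EFinP; apply: measurable_funS mk => // x [].
- apply: aeW => x Dx; rewrite patchE; case: ifPn => xab; last first.
    apply: cvg_near_cst; near=> n; rewrite /phi /bump ifN ?mulr0//.
    by apply: contra xab => xab; rewrite inE/= in_itv.
  move: xab; rewrite inE/= in_itv/= => xab.
  apply: cvg_EFin; first exact: nearW.
  rewrite -[X in _ --> X]mulr1; apply: cvgM; first exact: cvg_cst.
  rewrite /phi /bump xab.
  under eq_fun do rewrite expr0 mul1r.
  have : expR (- (c n * ((x - a) * (b - x))^-1)) @[n --> \oo] -->
      expR (- (0 * ((x - a) * (b - x))^-1)).
    apply: continuous_cvg; first exact: continuous_expR.
    apply: cvgN; apply: cvgM; last exact: cvg_cst.
    exact: cvg_harmonic.
  by rewrite mul0r oppr0 expR0.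
- exact: integrable_norm.
- by apply: aeW => x n Dx; rewrite lee_fin normrM ler_piMr.
move=> _ _ /(cvg_lim (@ereal_hausdorff R)) h.
rewrite /Rintegral; have -> : (\int[mu]_(x in `]a, b[) (k x)%:E = 0)%E; last by [].
transitivity (\int[mu]_(x in `]0%R, T[) ((EFin \o k) \_ `]a, b[) x)%E.
  by rewrite -integral_mkcondr; congr (integral _ _ _); apply/esym/setIidPr.
rewrite -h; apply/cvg_lim => //; apply: cvg_near_cst; apply: nearW => n.
rewrite -[LHS]fineK; first by congr EFin; exact: k_test (tphi n).
exact: integrable_fin_num (intkphi n).
Unshelve. all: by end_near. Qed.

(** The primitive of k is constant on ]0, T[, while its derivative is k almost
    everywhere by Lebesgue's differentiation theorem. *)
Lemma test0_ae0 : {ae mu, forall x, `]0, T[%classic x -> k x = 0}.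
Proof.
have mD : measurable (`]0, T[%classic : set R) by exact: measurable_itv.
pose f := k \_ `]0, T[.
have intf (A : set R) : measurable A -> mu.-integrable A (EFin \o f).
  move=> mA; apply: (@integrableS _ _ _ mu setT) => //.
  by have := (@integrable_mkcond _ _ _ mu _ (EFin \o k) mD).1 intk; rewrite (restrict_EFin k).
have locf : locally_integrable [set: R] f.
  by apply: open_integrable_locally => //; [exact: openT|exact: intf].
have := FTC1Ny (fun y => intf _ (measurable_itv _)) locf.
apply: (@filterS _ _ (ae_filter_ringOfSetsType mu)) => x [_ F'x] xT.
rewrite -[LHS](_ : f x = _); last by rewrite /f patchE mem_set.
rewrite -F'x derive1E.
set F := (fun x => _) in F'x *.
rewrite (@near_eq_derive _ _ _ _ (cst (F x))); first by rewrite derive_cst.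
have : x \in `]0, T[ by [].
move=> /near_in_itvoo; apply: filterS => y yT.
have H u v : u \in `]0, T[ -> v \in `]0, T[ -> u <= v -> F u = F v.
  rewrite !in_itv/= => /andP[u0 uT] /andP[v0 vT]; rewrite le_eqVlt => /predU1P[->//|uv].
  apply/eqP; rewrite eq_sym -subr_eq0; apply/eqP.
  rewrite /F Rintegral_itvB//; last by rewrite bnd_simp ltW.
    rewrite -Rintegral_itv_bndo_bndc; last exact: intf.
    rewrite -(Rintegral_test0_itv u0 uv vT); apply: eq_Rintegral => z.
    rewrite inE/= in_itv/= => /andP[uz zv]; rewrite /f patchE mem_set//=.
    by rewrite in_itv/= (lt_trans u0 uz) (lt_trans zv vT).
  exact: intf.
by rewrite /cst; have [/H->|/ltW /H ->] := leP y x.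
Qed.

End fundamental_lemma.

(** The weak derivative is a choice among all representatives; the fundamental
    lemma, applied to the difference of two of them, makes the choice
    harmless. *)
Lemma weak_derivative_ae g h : is_W11_derivative T g h ->
  mu.-integrable `]0, T[ (EFin \o weak_derivative T g) /\
  {ae mu, forall x, `]0, T[%classic x -> weak_derivative T g x = h x}.
Proof.
move=> gh; have mD : measurable (`]0, T[%classic : set R) by exact: measurable_itv.
have [ig iw gw] : is_W11_derivative T g (weak_derivative T g).
  by rewrite /weak_derivative; case: xgetP => [? -> //|/(_ h)].
split => //; case: gh => _ ih gh.
pose k x := weak_derivative T g x - h x.
have ik : mu.-integrable `]0, T[ (EFin \o k).
  by have := @integrableB _ _ _ mu _ mD _ _ iw ih.
suff : {ae mu, forall x, `]0, T[%classic x -> k x = 0}.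
  by apply: (@filterS _ _ (ae_filter_ringOfSetsType mu)) => x kx /kx/eqP; rewrite subr_eq0 => /eqP.
apply: test0_ae0 => // phi tphi.
have cphi : continuous phi.
  move=> x; apply: differentiable_continuous; apply/derivable1_diffP.
  by have := tphi.1 0%N x; rewrite derive1n0.
have mphi : measurable_fun `]0, T[ phi.
  by apply: measurable_funTS; exact: continuous_measurable_fun.
have [M phiM] : exists M, forall x, `]0, T[%classic x -> `|phi x| <= M.
  have : compact (phi @` `[0, T]).
    apply: continuous_compact; last exact: segment_compact.
    exact: continuous_subspaceT.
  move=> /compact_bounded[M [_ MP]]; exists (M + 1) => x xT.
  apply: (MP (M + 1)); first by rewrite ltrDl.
  by exists x => //; exact: subset_itv_oo_cc xT.
have i1 : mu.-integrable `]0, T[ (EFin \o (fun x => weak_derivative T g x * phi x)).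
  by apply: integrable_mul_bounded => //; exists M.
have i2 : mu.-integrable `]0, T[ (EFin \o (fun x => h x * phi x)).
  by apply: integrable_mul_bounded => //; exists M.
under eq_Rintegral do rewrite /k mulrBl.
rewrite RintegralB//; apply/eqP; rewrite subr_eq0 -eqr_opp; apply/eqP.
by rewrite -gw// -gh.
Qed.

(** A test function vanishes at 0 and at T, so the integral of (g phi)' is 0. *)
Lemma is_W11_derivative_C1 g h : 0 < T ->
  (forall x : R, is_derive x 1 g (h x)) -> continuous h -> is_W11_derivative T g h.
Proof.
move=> T0 dg ch.
have cg : continuous g by move=> x; exact: continuous_is_derive (dg x).
have iT f : continuous f -> mu.-integrable `]0, T[ (EFin \o f).
  move=> cf; apply: (@integrableS _ _ _ mu `[0, T]) => //.
    exact: subset_itv_oo_cc.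
  by apply: integrable_within => x _; exact: cf.
split; [exact: iT|exact: iT|move=> phi [sphi [K [cK KT phiK]]]].
have dphi (x : R) : is_derive x 1 phi (phi^`()%classic x).
  by rewrite derive1E; apply: derivableP; have := sphi 0%N x; rewrite derive1n0.
have cphi : continuous phi by move=> x; exact: continuous_is_derive (dphi x).
have cphi' : continuous phi^`()%classic.
  move=> x; apply: differentiable_continuous; apply/derivable1_diffP.
  by have := sphi 1%N x; rewrite derive1n1.
have cghp : continuous (fun x => g x * phi^`()%classic x).
  by move=> x; apply: continuousM; [exact: cg|exact: cphi'].
have chp : continuous (fun x => h x * phi x).
  by move=> x; apply: continuousM; [exact: ch|exact: cphi].
have csum : continuous (fun x => g x * phi^`()%classic x + h x * phi x).
  by move=> x; apply: cvgD; [exact: cghp|exact: chp].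
apply/eqP; rewrite -addr_eq0 -RintegralD//; [|exact: iT..].
rewrite Rintegral_itv_obnd_cbnd; last exact: iT.
rewrite Rintegral_itv_bndo_bndc; last first.
  apply: (@integrableS _ _ _ mu `[0, T]) => //; first by apply: subset_itvl; rewrite bnd_simp.
  by apply: integrable_within => x _; exact: csum.
have out x : ~ x \in `]0, T[ -> phi x = 0 by move=> xT; apply: phiK => /KT.
apply/eqP; transitivity (g T * phi T - g 0 * phi 0); last first.
  by rewrite !out ?in_itv/= ?ltxx ?andbF// !mulr0 subrr.
apply: (@Rintegral_FTC_within _ (fun x => g x * phi x)) => //; first exact: ltW.
- move=> x _; have ? := dg x; have ? := dphi x.
  by apply: is_derive_eq; rewrite /GRing.scale/= (mulrC (phi x)).
- by move=> x _; exact: csum.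
Qed.

End weak_derivative.

(** * The fractional derivatives of a monomial *)

Section values.
Variable R : realType.
Notation mu := (@lebesgue_measure R).
Implicit Types (b t T : R) (n : nat).

Lemma within_continuous_powR b t : 0 < b -> 0 < t ->
  {within `[0, t], continuous (fun s => s `^ b)}.
Proof.
move=> b0 t0; apply/continuous_within_itvP => //; split.
- by move=> s; rewrite in_itv/= => /andP[s0 _]; exact: continuous_powR.
- by rewrite powR0 ?gt_eqF//; exact: powR_cvg0.
- by apply: cvg_at_left_filter; exact: continuous_powR.
Qed.

Lemma Rintegral_powR b t : 0 < b -> 0 < t ->
  \int[mu]_(s in `[0, t]) s `^ b = t `^ (b + 1) / (b + 1).
Proof.
move=> b0 t0; have b10 : 0 < b + 1 by rewrite addr_gt0.
rewrite /Rintegral (@continuous_FTC2 _ _ (fun s => s `^ (b + 1) / (b + 1)) 0 t) //.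
- by rewrite powR0 ?gt_eqF// mul0r sube0.
- exact: within_continuous_powR.
- split.
  + move=> s; rewrite in_itv/= => /andP[s0 _].
    by have ? := is_derive1_powR (b + 1) s0; apply: derivableM.
  + apply: cvgM; last exact: cvg_cst.
    by rewrite powR0 ?gt_eqF//; exact: powR_cvg0.
  + apply: cvgM; last exact: cvg_cst.
    by apply: cvg_at_left_filter; exact: continuous_powR.
- move=> s; rewrite in_itv/= => /andP[s0 _].
  have ? := is_derive1_powR (b + 1) s0.
  have [] : is_derive s 1 (fun s => s `^ (b + 1) / (b + 1)) (s `^ b).
    apply: is_derive_eq; rewrite /GRing.scale/= addrK mulr0 add0r.
    by field; rewrite gt_eqF.
  by rewrite derive1E.
Qed.

Section monomial.
Variables (n : nat) (T : R).
Hypothesis T0 : 0 < T.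
Let g t : R := t ^+ n.+1.
Let g' t : R := n.+1%:R * t ^+ n.

Let cg' : continuous g'.
Proof. by move=> t; apply: cvgM; [exact: cvg_cst|exact: exprn_continuous]. Qed.

Lemma weak_derivative_monomial :
  mu.-integrable `]0, T[ (EFin \o weak_derivative T g) /\
  {ae mu, forall t, `]0, T[%classic t -> weak_derivative T g t = g' t}.
Proof.
by apply: weak_derivative_ae; apply: is_W11_derivative_C1 => // t; exact: is_derive_exprn.
Qed.

(** The weak derivative is known to be measurable only on ]0, T[; the endpoint 0
    is removed first. *)
Lemma Rintegral_weak_derivative_monomial (q : R -> R) t : 0 < t < T ->
  measurable_fun setT q ->
  \int[mu]_(s in `[0, t]) (weak_derivative T g s * q s) =
  \int[mu]_(s in `[0, t]) (g' s * q s).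
Proof.
move=> /andP[t0 tT] mq; have [iw wE] := weak_derivative_monomial.
have sub : `]0, t]%classic `<=` `]0, T[%classic.
  by move=> s; rewrite /= !in_itv/= => /andP[-> /le_lt_trans->].
have mq' (D : set R) : measurable D -> measurable_fun D q.
  by move=> mD; exact: measurable_funTS.
have mw : measurable_fun `]0, t] (weak_derivative T g).
  by apply: measurable_funS sub _ => //; apply/measurable_EFinP; exact: (measurable_int mu iw).
have mwq : measurable_fun `]0, t] (fun s => weak_derivative T g s * q s).
  by apply: measurable_funM => //; exact: mq'.
have mg'q : measurable_fun `]0, t] (fun s => g' s * q s).
  apply: measurable_funM; last exact: mq'.
  by apply: measurable_funTS; exact: continuous_measurable_fun.
rewrite /Rintegral -!integral_itv_obnd_cbnd; [|exact/measurable_EFinP..].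
congr fine; apply: ae_eq_integral => //; [exact/measurable_EFinP..|].
apply: (@filterS _ _ (ae_filter_ringOfSetsType mu)) wE => s wE /sub /wE.
by rewrite /g /= => ->.
Qed.

Lemma Caputo_Fabrizio_monomial b t : 0 < b < 1 -> 0 < t < T ->
  Caputo_Fabrizio T b g t = n.+1%:R / b * exp_conv ((1 - b) / b) n t.
Proof.
move=> /andP[b0 b1] tT; have /andP[t0 _] := tT.
have c0 : (1 - b) / b != 0 by rewrite gt_eqF// divr_gt0// subr_gt0.
have ck : continuous (fun s => expR (- ((1 - b) / b) * (t - s))).
  by move=> s; apply: continuous_is_derive.
rewrite /Caputo_Fabrizio Rintegral_weak_derivative_monomial//; last first.
  exact: continuous_measurable_fun.
rewrite -Rintegral_exp_conv ?ltW// [X in _ = X * _]mulrC -mulrA -RintegralZl//.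
  by congr (_ * _); apply: eq_Rintegral => s _; rewrite /g' mulrA.
apply: integrable_within => s _; apply: continuousM; last exact: ck.
exact: exprn_continuous.
Qed.

Lemma Caputo_monomial b t : 0 < b -> 0 < t < T ->
  Caputo T b g t = n.+1`!%:R / Gamma (b + n.+1%:R) * t `^ (n%:R + b).
Proof.
move=> b0 tT; have /andP[t0 _] := tT.
rewrite /Caputo Rintegral_weak_derivative_monomial//; last first.
  apply: (measurableT_comp (measurable_powR (b - 1))).
  exact: measurable_funB.
under eq_Rintegral do rewrite /g' -mulrA.
rewrite -Rintegral_itv_bndo_bndc; last first.
  have := @integrableZl _ _ _ mu _ (measurable_itv _) n.+1%:R _ (integrable_beta t0 n b0).
  exact.
rewrite RintegralZl//; last exact: integrable_beta.
rewrite Rintegral_itv_bndo_bndc ?Rintegral_beta//; last exact: integrable_beta.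
rewrite GammaDn//; move: (Gamma b) => G.
by rewrite invfM factS natrM; ring.
Qed.

(** When a fractional derivative stays below g', the absolute value in the norm
    disappears and the norm becomes an explicit integral. *)
Lemma L1norm_monomial (A q : R -> R) :
  (forall t, 0 < t < T -> A t = q t) ->
  measurable_fun `]0, T[ q ->
  (forall t, 0 < t < T -> q t <= g' t) ->
  L1norm T (A \- weak_derivative T g) = \int[mu]_(t in `]0, T[) (g' t - q t).
Proof.
move=> Aq mq qg; have [iw wE] := weak_derivative_monomial.
have mD : measurable (`]0, T[%classic : set R) by exact: measurable_itv.
rewrite /L1norm Lnorm1 /Rintegral; congr fine.
transitivity (\int[mu]_(t in `]0%R, T[) `|(q t - weak_derivative T g t)%:E|)%E.
  rewrite [RHS]integral_mkcond; apply: eq_integral => t _.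
  rewrite /= !patchE; case: ifPn => [|_]; last by rewrite normr0.
  by rewrite inE/= in_itv/= => /Aq ->.
have mw : measurable_fun `]0, T[ (weak_derivative T g).
  by apply/measurable_EFinP; exact: (measurable_int mu iw).
apply: ae_eq_integral => //.
- by apply: measurableT_comp => //; apply/measurable_EFinP; exact: measurable_funB.
- apply/measurable_EFinP; apply: measurable_funB => //.
  by apply: measurable_funTS; exact: continuous_measurable_fun.
apply: (@filterS _ _ (ae_filter_ringOfSetsType mu)) wE => t wE /[dup] tT /wE ->.
by rewrite /= distrC ger0_norm// subr_ge0 qg//.
Qed.

End monomial.
End values.

(** * Asymptotics of the two norms *)

Section norms.
Variable R : realType.
Notation mu := (@lebesgue_measure R).
Variables (n : nat) (T : R).
Hypothesis T0 : 0 < T.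
Hypothesis Tn : T <= n.+1%:R.
Implicit Types b t : R.
Let g t : R := t ^+ n.+2.
Let g' t : R := n.+2%:R * t ^+ n.+1.

(** As b c = 1 - b, one step of the recurrence for [exp_conv] brings out a factor
    b, the order of the norm. The sign of the error is [exp_conv_le]. *)
Lemma L1norm_Caputo_Fabrizio b : 0 < b < 1 ->
  L1norm T (Caputo_Fabrizio T b g \- weak_derivative T g) =
  b * (((n.+2%:R * (T ^+ n.+1 - n.+1%:R * exp_conv ((1 - b) / b) n T)) / (1 - b)
    - T ^+ n.+2) / (1 - b)).
Proof.
move=> b01; have /andP[b0 b1] := b01.
have c0 : (1 - b) / b != 0 by rewrite gt_eqF// divr_gt0// subr_gt0.
have cconv : continuous (fun t => n.+2%:R / b * exp_conv ((1 - b) / b) n.+1 t).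
  move=> t; apply: cvgM; first exact: cvg_cst.
  exact: continuous_is_derive (is_derive_exp_conv n.+1 t c0).
have cg' : continuous g'.
  by move=> t; apply: cvgM; [exact: cvg_cst|exact: exprn_continuous].
have iT (f : R -> R) : continuous f -> mu.-integrable `[0, T] (EFin \o f).
  by move=> cf; apply: integrable_within => t _; exact: cf.
rewrite (@L1norm_monomial _ _ _ T0 _ (fun t => n.+2%:R / b * exp_conv ((1 - b) / b) n.+1 t)).
- have cB : continuous (fun t => g' t - n.+2%:R / b * exp_conv ((1 - b) / b) n.+1 t).
    by move=> t; apply: cvgB; [exact: cg'|exact: cconv].
  rewrite Rintegral_itv_obnd_cbnd; last first.
    by apply: (integrableS _ _ _ (iT _ cB)) => //; exact: subset_itv_oo_cc.
  rewrite Rintegral_itv_bndo_bndc; last first.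
    by apply: (integrableS _ _ _ (iT _ cB)) => //; apply: subset_itvl; rewrite bnd_simp.
  rewrite RintegralB//; [|exact: iT..].
  have -> : \int[mu]_(t in `[0, T]) g' t = T ^+ n.+2.
    transitivity (T ^+ n.+2 - 0 ^+ n.+2 : R); last by rewrite expr0n/= subr0.
    apply: (@Rintegral_FTC_within _ (fun t => t ^+ n.+2)); first exact: ltW.
    by move=> t _; exact: cg'.
  rewrite RintegralZl//; last first.
    by apply: iT => t; exact: continuous_is_derive (is_derive_exp_conv n.+1 t c0).
  rewrite Rintegral_of_exp_conv ?(ltW T0)//.
  rewrite invf_div /= invf_div; move: (exp_conv _ n T) => y.
  have b1' : 1 - b != 0 by rewrite subr_eq0 gt_eqF.
  by field; rewrite b1' (gt_eqF b0) -natrD pnatr_eq0.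
- by move=> t tT; rewrite -(Caputo_Fabrizio_monomial n.+1 T0 b01 tT).
- by apply: measurable_funTS; exact: continuous_measurable_fun.
- move=> t /andP[t0 tT]; rewrite -mulrA ler_pM2l ?ltr0n// ler_pdivrMl//.
  by apply: exp_conv_le => //; rewrite (ltW t0) (le_trans (ltW tT)).
Qed.

Lemma cvg_L1norm_Caputo_Fabrizio :
  b^-1 * L1norm T (Caputo_Fabrizio T b g \- weak_derivative T g) @[b --> 0^'+]
  --> T ^+ n.+1 * (n.+2%:R - T).
Proof.
pose N b := ((n.+2%:R * (T ^+ n.+1 - n.+1%:R * exp_conv ((1 - b) / b) n T)) / (1 - b)
    - T ^+ n.+2) / (1 - b).
apply: (@cvg_trans _ (N b @[b --> 0^'+])).
  apply: near_eq_cvg; near=> b.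
  have b0 : 0 < b by near: b; exact: nbhs_right_gt.
  have b1 : b < 1 by near: b; exact: nbhs_right_lt.
  by rewrite L1norm_Caputo_Fabrizio ?b0// mulKf// gt_eqF.
have -> : T ^+ n.+1 * (n.+2%:R - T) =
    ((n.+2%:R * (T ^+ n.+1 - n.+1%:R * 0)) / (1 - 0) - T ^+ n.+2) / (1 - 0).
  by rewrite mulr0 !subr0 !divr1 [T ^+ n.+2]exprS; ring.
have cV : (1 - b)^-1 @[b --> 0^'+] --> ((1 - 0)^-1 : R).
  apply: cvgV; first by rewrite subr0.
  by apply: cvgB; [exact: cvg_cst|apply: cvg_at_right_filter; exact: cvg_id].
apply: cvgM => //; apply: cvgB; last exact: cvg_cst.
apply: cvgM => //; apply: cvgM; first exact: cvg_cst.
apply: cvgB; first exact: cvg_cst.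
apply: cvgM; first exact: cvg_cst.
exact: cvg_exp_conv (ltW T0).
Unshelve. all: by end_near. Qed.

(** Normalized to be 1 at b = 0, where its derivative is Psi(m+1) - ln T, for
    m = n + 2. *)
Definition gamma_ratio b : R :=
  Gamma (n.+3%:R + b) * T `^ (- b) / n.+2`!%:R.

(** The tangent inequality at the integer x = k + 2, where for t <= k + 1 the
    correction term is nonnegative. *)
Lemma Gamma_ge b t : 0 <= b -> 0 < t -> forall k,
  t `^ b * (k.+1`!%:R + b * k`!%:R * (k.+1%:R - t)) <= Gamma (k.+2%:R + b).
Proof.
move=> b0 t0 k; apply: le_trans (Gamma_tangent _ b0 t0); last by rewrite ltr1n.
rewrite ler_wpM2l ?powR_ge0//.
have -> : k.+2%:R - 1 = k.+1%:R :> R by rewrite -(natr1 k.+1) addrK.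
by rewrite !GammaS factS natrM; lra.
Qed.

Lemma gamma_ratio_ge b : 0 <= b ->
  1 + b * (1 - T / n.+2%:R) <= gamma_ratio b.
Proof.
move=> b0; rewrite /gamma_ratio ler_pdivlMr ?ltr0n ?fact_gt0//.
rewrite powRN ler_pdivlMr ?powR_gt0// mulrC.
apply: le_trans (Gamma_ge b0 T0 n.+1); rewrite ler_wpM2l ?powR_ge0//.
rewrite factS natrM le_eqVlt; apply/orP; left; apply/eqP.
by field; rewrite -natrD pnatr_eq0.
Qed.

(** The comparison with g' reduces to t^b Gamma(m) <= Gamma(m + b), which holds
    for t <= m - 1. *)
Lemma L1norm_Caputo b : 0 < b ->
  L1norm T (Caputo T b g \- weak_derivative T g) =
  T ^+ n.+2 * (gamma_ratio b - 1) / gamma_ratio b.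
Proof.
move=> b0.
have Gp : 0 < Gamma (b + n.+2%:R).
  have t0 : 0 < n.+1%:R :> R by rewrite ltr0n.
  rewrite addrC; apply: lt_le_trans (Gamma_ge (ltW b0) t0 n).
  by rewrite mulr_gt0 ?powR_gt0// subrr mulr0 addr0 ltr0n fact_gt0.
set C := n.+2`!%:R / Gamma (b + n.+2%:R).
have nb0 : 0 < n.+1%:R + b by rewrite addr_gt0// ltr0n.
have iq : mu.-integrable `[0, T] (EFin \o (fun t => C * t `^ (n.+1%:R + b))).
  have ip : mu.-integrable `[0, T] (EFin \o (fun t => t `^ (n.+1%:R + b))).
    apply: continuous_compact_integrable; first exact: segment_compact.
    exact: within_continuous_powR.
  by have := @integrableZl _ _ _ mu _ (measurable_itv _) C _ ip.
have cg' : continuous g'.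
  by move=> t; apply: cvgM; [exact: cvg_cst|exact: exprn_continuous].
have ig' : mu.-integrable `[0, T] (EFin \o g').
  by apply: integrable_within => t _; exact: cg'.
have iB : mu.-integrable `[0, T] (EFin \o (fun t => g' t - C * t `^ (n.+1%:R + b))).
  by have := @integrableB _ _ _ mu _ (measurable_itv _) _ _ ig' iq.
rewrite (@L1norm_monomial _ _ _ T0 _ (fun t => C * t `^ (n.+1%:R + b))).
- rewrite Rintegral_itv_obnd_cbnd; last first.
    by apply: (integrableS _ _ _ iB) => //; exact: subset_itv_oo_cc.
  rewrite Rintegral_itv_bndo_bndc; last first.
    by apply: (integrableS _ _ _ iB) => //; apply: subset_itvl; rewrite bnd_simp.
  rewrite RintegralB//.
  have -> : \int[mu]_(t in `[0, T]) g' t = T ^+ n.+2.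
    transitivity (T ^+ n.+2 - 0 ^+ n.+2 : R); last by rewrite expr0n/= subr0.
    apply: (@Rintegral_FTC_within _ (fun t => t ^+ n.+2)); first exact: ltW.
    by move=> t _; exact: cg'.
  rewrite RintegralZl//; last first.
    apply: continuous_compact_integrable; first exact: segment_compact.
    exact: within_continuous_powR.
  rewrite Rintegral_powR//.
  have nb20 : 0 < b + n.+2%:R by rewrite addr_gt0// ltr0n.
  rewrite /gamma_ratio.
  have -> : n.+3%:R + b = b + n.+2%:R + 1 by rewrite -natr1; ring.
  rewrite GammaD1// /C.
  have -> : n.+1%:R + b + 1 = b + n.+2%:R by rewrite -(natr1 n.+1); ring.
  rewrite (addrC b n.+2%:R) powRD ?(gt_eqF T0) ?implybT// powR_mulrn ?(ltW T0)//.
  rewrite (addrC n.+2%:R) powRN; move: Gp; move: (Gamma _) => G Gp.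
  have := powR_gt0 b T0; move: (T `^ b) => p p0.
  have : 0 < n.+2`!%:R :> R by rewrite ltr0n fact_gt0.
  move: (n.+2`!%:R : R) => f f0.
  field; rewrite (gt_eqF f0) (gt_eqF p0) (gt_eqF Gp) -natrD.
  exact: lt0r_neq0 nb20.
- by move=> t tT; rewrite -(Caputo_monomial n.+1 T0 b0 tT).
- apply: measurable_funM => //; apply: measurable_funTS; exact: measurable_powR.
- move=> t /andP[t0 tT].
  rewrite powRD ?(gt_eqF t0) ?implybT// powR_mulrn ?(ltW t0)// mulrCA mulrC.
  rewrite ler_wpM2r ?exprn_ge0 ?(ltW t0)// /C mulrAC ler_pdivrMr//.
  rewrite factS natrM -mulrA ler_pM2l ?ltr0n// (addrC b) mulrC.
  apply: le_trans (Gamma_ge (ltW b0) t0 n); rewrite ler_wpM2l ?powR_ge0// lerDl.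
  rewrite mulr_ge0 ?mulr_ge0 ?(ltW b0)// subr_ge0 (le_trans (ltW tT))//.
Qed.

Lemma cvg_gamma_ratio :
  b^-1 * (gamma_ratio b - 1) @[b --> 0^'+] --> digamma (n.+3%:R : R) - ln T.
Proof.
have n3 : 0 < n.+3%:R :> R by rewrite ltr0n.
have dG : is_derive (n.+3%:R + 0 : R) 1 (@Gamma R) ((@Gamma R)^`()%classic n.+3%:R).
  by rewrite addr0 derive1E; apply: derivableP; exact: derivable_Gamma.
have dG' : is_derive (0 : R) 1 (fun b => Gamma (n.+3%:R + b)) ((@Gamma R)^`()%classic n.+3%:R).
  have ? : is_derive (0 : R) 1 (fun b => n.+3%:R + b) 1.
    by apply: is_derive_eq; ring.
  rewrite -[X in is_derive _ _ _ X]mulr1.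
  exact: (@is_derive1_comp _ (@Gamma R) (fun b => n.+3%:R + b)).
have dT : is_derive (0 : R) 1 (fun b => T `^ (- b)) (- ln T).
  have -> : (fun b => T `^ (- b)) = (fun b => expR (- b * ln T)).
    by apply/funext => b; rewrite /powR gt_eqF.
  apply: is_derive_eq; rewrite /GRing.scale/= oppr0 mul0r expR0; ring.
have Gn : Gamma (n.+3%:R : R) = n.+2`!%:R by rewrite GammaS.
have f0 : n.+2`!%:R != 0 :> R by rewrite pnatr_eq0 -lt0n fact_gt0.
have [dr rE] : is_derive (0 : R) 1 gamma_ratio (digamma (n.+3%:R : R) - ln T).
  rewrite /gamma_ratio; apply: is_derive_eq; rewrite /GRing.scale/=.
  by rewrite addr0 Gn oppr0 powRr0 /digamma Gn; field.
have r1 : gamma_ratio 0 = 1.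
  by rewrite /gamma_ratio addr0 oppr0 powRr0 mulr1 Gn divff.
move: dr => /cvg_ex[l drl].
have := drl; rewrite -rE => /cvg_lim; rewrite /derive => -> //.
move: drl => /cvg_dnbhs_at_right; apply: cvg_trans; apply: near_eq_cvg.
by near=> b; rewrite /GRing.scale/= mulr1 addr0 r1.
Unshelve. all: by end_near. Qed.

Lemma cvg_gamma_ratio1 : gamma_ratio b @[b --> 0^'+] --> (1 : R).
Proof.
have h : 1 + b * (b^-1 * (gamma_ratio b - 1)) @[b --> 0^'+] -->
    1 + 0 * (digamma (n.+3%:R : R) - ln T).
  apply: cvgD; first exact: cvg_cst.
  apply: cvgM; last exact: cvg_gamma_ratio.
  by apply: cvg_at_right_filter; exact: cvg_id.
move: h; rewrite mul0r addr0; apply: cvg_trans; apply: near_eq_cvg; near=> b.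
have b0 : 0 < b by near: b; exact: nbhs_right_gt.
by rewrite mulVKf ?gt_eqF// subrKC.
Unshelve. all: by end_near. Qed.

(** The lower bound on the ratio passes to its derivative at 0, which is thus at
    least 1 - T/m; in particular the limit of the Caputo norms, divided by b, is
    not 0. *)
Lemma digamma_sub_ln_gt0 : 0 < digamma (n.+3%:R : R) - ln T.
Proof.
apply: (@lt_le_trans _ _ (1 - T / n.+2%:R)).
  rewrite subr_gt0 ltr_pdivrMr ?ltr0n// mul1r (le_lt_trans Tn)// ltr_nat//.
apply: (cvgr_to_ge cvg_gamma_ratio); near=> b.
have b0 : 0 < b by near: b; exact: nbhs_right_gt.
rewrite ler_pdivlMl// lerBrDl; exact: gamma_ratio_ge (ltW b0).
Unshelve. all: by end_near. Qed.

Lemma cvg_L1norm_Caputo :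
  b^-1 * L1norm T (Caputo T b g \- weak_derivative T g) @[b --> 0^'+]
  --> T ^+ n.+2 * (digamma (n.+3%:R : R) - ln T).
Proof.
have -> : T ^+ n.+2 * (digamma (n.+3%:R : R) - ln T) =
    T ^+ n.+2 * (digamma (n.+3%:R : R) - ln T) / 1 by rewrite divr1.
apply: (@cvg_trans _ (T ^+ n.+2 * (b^-1 * (gamma_ratio b - 1)) / gamma_ratio b @[b --> 0^'+])).
  apply: near_eq_cvg; near=> b.
  have b0 : 0 < b by near: b; exact: nbhs_right_gt.
  by rewrite L1norm_Caputo// mulrCA !mulrA.
apply: cvgM; last by apply: cvgV; [exact: oner_neq0|exact: cvg_gamma_ratio1].
by apply: cvgM; [exact: cvg_cst|exact: cvg_gamma_ratio].
Unshelve. all: by end_near. Qed.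

End norms.

(** Both norms are of order b, so dividing each of them by b leaves the quotient
    of the two limits. *)
Theorem theorem5 (R : realType) (m : nat) (m_ge2 : (2 <= m)%N)
    (T : R) (T_gt0 : 0 < T) (T_le : T <= m%:R - 1) :
  let g := fun t : R => t ^+ m in
  (fun b : R =>
     L1norm T (Caputo_Fabrizio T b g \- weak_derivative T g) /
     L1norm T (Caputo T b g \- weak_derivative T g)) @ 0^'+
  --> (m%:R - T) / T * (1 / (digamma (m.+1%:R : R) - ln T)).
Proof.
case: m m_ge2 T_le => [|[|n]]// _ Tm g.
have Tn : T <= n.+1%:R by rewrite -(natr1 n.+1) addrK in Tm.
have psi0 := digamma_sub_ln_gt0 T_gt0 Tn.
have -> : (n.+2%:R - T) / T * (1 / (digamma (n.+3%:R : R) - ln T)) =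
    T ^+ n.+1 * (n.+2%:R - T) / (T ^+ n.+2 * (digamma (n.+3%:R : R) - ln T)).
  have : 0 < T ^+ n.+1 by rewrite exprn_gt0.
  rewrite [T ^+ n.+2]exprS; move: (T ^+ n.+1) => p p0.
  by field; rewrite !gt_eqF.
apply: (@cvg_trans _ ((b^-1 * L1norm T (Caputo_Fabrizio T b g \- weak_derivative T g)) /
    (b^-1 * L1norm T (Caputo T b g \- weak_derivative T g)) @[b --> 0^'+])).
  apply: near_eq_cvg; near=> b.
  have b0 : 0 < b by near: b; exact: nbhs_right_gt.
  by rewrite -mulf_div divff ?mul1r// invr_eq0 gt_eqF.
apply: cvgM; first exact: cvg_L1norm_Caputo_Fabrizio.
apply: cvgV; first by rewrite mulf_neq0// ?gt_eqF// exprn_gt0.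
exact: cvg_L1norm_Caputo.
Unshelve. all: by end_near. Qed.
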